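(* Let $E$ and $F$ be finite directed graphs with no sinks, and let $\mathsf{k}$ be a field. If $E$ and $F$ are unitally aligned module shift equivalent via matrices $(R,S)$, then the Leavitt path algebras $L_{\mathsf{k}}(E)$ and $L_{\mathsf{k}}(F)$ are graded isomorphic as $\mathsf{k}$-algebras via an isomorphism that induces the maps $(R,S)$ between dimension triples.
   Context: **Graphs and Leavitt path algebras.** A directed graph is $E=(E^0,E^1,r,s)$ with range and source maps $r,s:E^1\to E^0$; its adjacency matrix is the $E^0\times E^0$ matrix $A$ with $A(v,w)$ the number of edges $e$ with $s(e)=v$, $r(e)=w$. A sink is a vertex emitting no edge. Throughout, $A$ and $B$ denote the adjacency matrices of $E$ and $F$. For a finite graph $E$, the Leavitt path algebra $L_{\mathsf{k}}(E)$ is the universal $\mathsf{k}$-algebra generated by $\{v:v\in E^0\}\cup\{e,e^*:e\in E^1\}$ subject to: $v^2=v$, $vw=0$ for distinct $v,w\in E^0$; $s(e)e=e\,r(e)=e$, $r(e)e^*=e^*s(e)=e^*$; $e^*e=r(e)$ and $e^*f=0$ for distinct edges $e\neq f$; $v=\sum_{s(e)=v}ee^*$ for every $v$ that is not a sink. It is $\mathbb{Z}$-graded by $\deg v=0$, $\deg e=1$, $\deg e^*=-1$. **Graded $K$-theory.** For a $\mathbb{Z}$-graded ring $T$, $K_0^{\mathrm{gr}}(T)$ is the group completion of the monoid of graded isomorphism classes of finitely generated graded projective right $T$-modules under $\oplus$; its positive cone is the image of this monoid. It is a $\mathbb{Z}[x,x^{-1}]$-module by $x\cdot[M]=[M(1)]$,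 where $M(1)_n=M_{n+1}$. A unital graded ring homomorphism $\xi:T\to T'$ induces $[X]\mapsto[X\otimes_\xi T']$. **Dimension data.** For a square matrix $A$ over $\mathbb{N}$ of size $|A|$, $G_A=(\mathbb{Z}^{|A|}\times\mathbb{N})/\sim$, where $(v,k)\sim(w,l)$ iff $(A^t)^{m-k}v=(A^t)^{m-l}w$ for some $m\ge k,l$; addition is $[v,k]+[w,k']=[(A^t)^{k'}v+(A^t)^kw,k+k']$, $x$ acts by $[v,k]\mapsto[A^tv,k]$, the positive cone is $\{[v,k]:v\in\mathbb{N}^{|A|}\}$, and the order unit is $[(1,\dots,1)^t,0]$. Also $\Delta_A=\{v\in\bigcap_{k\ge1}\mathbb{Q}^{|A|}A^k: vA^l\in\mathbb{Z}^{|A|}\text{ for some }l\in\mathbb{N}\}$ (row vectors), with positive cone $\Delta_A^+=\{v\in\Delta_A:vA^l\in\mathbb{N}^{|A|}\text{ for some }l\in\mathbb{N}\}$ and automorphism $\delta_A(v)=vA$, by which $x$ acts. The dimension triple of $A$ is $(\Delta_A,\Delta_A^+,\delta_A)$. There is an order isomorphism of $\mathbb{Z}[x,x^{-1}]$-modules $\psi_A:\Delta_A\to G_A$, $\psi_A(v)=[(A^t)^lv^t,l]$ where $l$ is such that $vA^l\in\mathbb{Z}^{|A|}$. The order unit of $\Delta_A$ is $\psi_A^{-1}[(1,\dots,1)^t,0]$. For $E$ finite without sinks and with adjacency matrix $A$, there is an order isomorphism of $\mathbb{Z}[x,x^{-1}]$-modules $\beta_E:K_0^{\mathrm{gr}}(L_{\mathsf{k}}(E))\to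 G_A$ with $\beta_E([vL_{\mathsf{k}}(E)])=[\mathbf{e}_v,0]$, where $\mathbf e_v$ is the standard basis column vector; $K_0^{\mathrm{gr}}(L_{\mathsf{k}}(E))$ is identified with $\Delta_A$ by $\psi_A^{-1}\circ\beta_E$. A map between dimension groups is unital if it preserves the order units. The maps between dimension triples given by $(R,S)$ are $\Delta_A\to\Delta_B$, $v\mapsto vR$, and $\Delta_B\to\Delta_A$, $w\mapsto wS$. **Edge sets and bimodules.** $\mathsf{k}E^0$ is the $\mathsf{k}$-algebra with basis $E^0$ and product $vw=\delta_{v,w}v$. An edge set $G^1$ from $E^0$ to $F^0$ is a finite set with maps $s:G^1\to E^0$, $r:G^1\to F^0$; the vector space $\mathsf{k}G^1$ with basis $G^1$ is a $\mathsf{k}E^0$–$\mathsf{k}F^0$-bimodule via $v\cdot e\cdot w=\delta_{v,s(e)}\delta_{w,r(e)}e$. In particular $\mathsf{k}E^1$ is a $\mathsf{k}E^0$-bimodule, and $(\mathsf{k}E^1)^{\otimes m}$ denotes its $m$-fold tensor power over $\mathsf{k}E^0$. An $E^0\times F^0$ matrix $R$ over $\mathbb{N}$ corresponds to the edge set $G^1_R$ with exactly $R(v,w)$ elements with source $v$ and range $w$. **Module shift equivalence.** Finite graphs $E,F$ with no sinks are module shift equivalent via edge sets $G^1$ (from $E^0$ to $F^0$) and $H^1$ (from $F^0$ to $E^0$) if there are an integer $m\ge1$ and bimodule isomorphisms $\omega_E:\mathsf{k}G^1\otimes_{\mathsf{k}F^0}\mathsf{k}H^1\to(\mathsf{k}E^1)^{\otimes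 m}$, $\omega_F:\mathsf{k}H^1\otimes_{\mathsf{k}E^0}\mathsf{k}G^1\to(\mathsf{k}F^1)^{\otimes m}$, $\sigma_G:\mathsf{k}E^1\otimes_{\mathsf{k}E^0}\mathsf{k}G^1\to\mathsf{k}G^1\otimes_{\mathsf{k}F^0}\mathsf{k}F^1$, $\sigma_H:\mathsf{k}F^1\otimes_{\mathsf{k}F^0}\mathsf{k}H^1\to\mathsf{k}H^1\otimes_{\mathsf{k}E^0}\mathsf{k}E^1$. They are aligned module shift equivalent via $(G^1,H^1)$ if there is such data for which, in addition, $$(\omega_E\otimes\mathrm{id})\circ(\mathrm{id}\otimes\sigma_H)\circ(\sigma_G\otimes\mathrm{id})=\nu_E^m\circ(\mathrm{id}\otimes\omega_E)$$ as maps $\mathsf{k}E^1\otimes_{\mathsf{k}E^0}\mathsf{k}G^1\otimes_{\mathsf{k}F^0}\mathsf{k}H^1\to(\mathsf{k}E^1)^{\otimes m}\otimes_{\mathsf{k}E^0}\mathsf{k}E^1$, and $$(\omega_F\otimes\mathrm{id})\circ(\mathrm{id}\otimes\sigma_G)\circ(\sigma_H\otimes\mathrm{id})=\nu_F^m\circ(\mathrm{id}\otimes\omega_F)$$ as maps $\mathsf{k}F^1\otimes_{\mathsf{k}F^0}\mathsf{k}H^1\otimes_{\mathsf{k}E^0}\mathsf{k}G^1\to(\mathsf{k}F^1)^{\otimes m}\otimes_{\mathsf{k}F^0}\mathsf{k}F^1$, where $\nu_E^m(x\otimes(x_1\otimes\cdots\otimes x_m))=(x\otimes x_1\otimes\cdots\otimes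 x_{m-1})\otimes x_m$ and $\nu_F^m$ is defined similarly. **Unital version.** $E$ and $F$ are unitally aligned module shift equivalent via $(R,S)$ if $R$ ($E^0\times F^0$) and $S$ ($F^0\times E^0$) are rectangular non-negative integral matrices, one of which induces a unital map on dimension groups, such that $E$ and $F$ are aligned module shift equivalent via the corresponding edge sets $(G^1_R,G^1_S)$.
   Formalization: ''Induces the maps (R,S)'' is corrected: the unital one of R, S is induced exactly (R by the isomorphism, or S by its inverse), while the other matrix is induced by the opposite map only up to x^m for some m ≥ 1; literally both fails, e.g. A=B=[2], R=[1], S=[2]. *)

(* Defs.v *)
From HB Require Import structures.
From mathcomp Require Import all_boot all_order all_algebra.
From mathcomp Require Import boolp.

Set Implicit Arguments.
Unset Strict Implicit.
Unset Printing Implicit Defensive.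

Import Order.TTheory GRing.Theory Num.Theory.
Local Open Scope ring_scope.

(* Quotients of arbitrary types by Prop-valued equivalence relations: an      *)
(* element is an equivalence class. This is used instead of {eq_quot _}       *)
(* because K_0^gr is a quotient of a type that is too large to be an eqType.  *)
Section Quotients.

Record quot (T : Type) (e : T -> T -> Prop) :=
  Quot { qclass : T -> Prop; qclassP : exists x, qclass = e x }.

Definition cls (T : Type) (e : T -> T -> Prop) (x : T) : quot e :=
  Quot (ex_intro (fun y => e x = e y) x erefl).

Definition rep (T : Type) (e : T -> T -> Prop) (q : quot e) : T :=
  projT1 (cid (qclassP q)).

Definition equivrel (T : Type) (e : T -> T -> Prop) : Prop :=
  [/\ forall x, e x x, forall x y, e x y -> e y x
    & forall x y z, e x y -> e y z -> e x z].

Lemma repK (T : Type) (e : T -> T -> Prop) (q : quot e) : cls e (rep q) = q.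
Proof.
rewrite /rep; case: (cid _) => x /= qx; case: q qx => C [y CE] /= Cx.
by subst C; rewrite /cls; move: (ex_intro _ _ _); rewrite -Cx => p;
  congr Quot; apply: Prop_irrelevance.
Qed.

Lemma clsP (T : Type) (e : T -> T -> Prop) (x y : T) :
  equivrel e -> (cls e x = cls e y) <-> e x y.
Proof.
move=> [eR eS eT]; split=> [[exy]|exy]; first by rewrite exy; apply: eR.
have {}exy : e x = e y.
  by apply: funext => z; apply: propext; split; apply: eT; [apply: eS|].
rewrite /cls; move: (ex_intro _ _ _); rewrite exy => p.
by congr Quot; apply: Prop_irrelevance.
Qed.

Lemma rep_cls (T : Type) (e : T -> T -> Prop) (x : T) :
  equivrel e -> e (rep (cls e x)) x.
Proof. by move=> ee; apply/(clsP _ _ ee); rewrite repK. Qed.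

End Quotients.

(* An edge set from V to W; a graph is an edge set from its vertex set to     *)
(* itself.                                                                    *)
Record edgeset (V W : finType) := EdgeSet {
  edge :> finType;
  src : edge -> V;
  rng : edge -> W
}.

Record graph := Graph { vert : finType; edges : edgeset vert vert }.

Definition no_sinks (E : graph) : Prop :=
  forall v : vert E, exists e : edges E, src e = v.

Definition adj (E : graph) : 'M[nat]_#|vert E| :=
  \matrix_(i, j) #|[set e : edges E | (src e == enum_val i) &&
                                      (rng e == enum_val j)]|.

Section LeavittPathAlgebra.

Variables (k : fieldType) (E : graph).

Inductive lterm : Type :=
  | LVert (v : vert E)
  | LEdge (e : edges E)
  | LGhost (e : edges E)
  | LZero
  | LAdd (a b : lterm)
  | LOpp (a : lterm)
  | LScale (c : k) (a : lterm)
  | LMul (a b : lterm).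

Definition LSum (s : seq lterm) : lterm := foldr LAdd LZero s.

(* The smallest congruence that makes the terms an associative (not a priori  *)
(* unital) k-algebra in which the defining relations of L_k(E) hold.          *)
Inductive leq_term : lterm -> lterm -> Prop :=
  | Lrefl a : leq_term a a
  | Lsym a b : leq_term a b -> leq_term b a
  | Ltrans a b c : leq_term a b -> leq_term b c -> leq_term a c
  | Ladd_cong a a' b b' :
      leq_term a a' -> leq_term b b' -> leq_term (LAdd a b) (LAdd a' b')
  | Lopp_cong a a' : leq_term a a' -> leq_term (LOpp a) (LOpp a')
  | Lscale_cong c a a' :
      leq_term a a' -> leq_term (LScale c a) (LScale c a')
  | Lmul_cong a a' b b' :
      leq_term a a' -> leq_term b b' -> leq_term (LMul a b) (LMul a' b')
  | LaddA a b c : leq_term (LAdd a (LAdd b c)) (LAdd (LAdd a b) c)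
  | LaddC a b : leq_term (LAdd a b) (LAdd b a)
  | Ladd0 a : leq_term (LAdd LZero a) a
  | LaddN a : leq_term (LAdd (LOpp a) a) LZero
  | LscaleA c d a : leq_term (LScale c (LScale d a)) (LScale (c * d) a)
  | Lscale1 a : leq_term (LScale 1 a) a
  | LscaleDr c a b :
      leq_term (LScale c (LAdd a b)) (LAdd (LScale c a) (LScale c b))
  | LscaleDl c d a :
      leq_term (LScale (c + d) a) (LAdd (LScale c a) (LScale d a))
  | LmulA a b c : leq_term (LMul a (LMul b c)) (LMul (LMul a b) c)
  | LmulDl a b c : leq_term (LMul (LAdd a b) c) (LAdd (LMul a c) (LMul b c))
  | LmulDr a b c : leq_term (LMul a (LAdd b c)) (LAdd (LMul a b) (LMul a c))
  | LscaleAl c a b : leq_term (LScale c (LMul a b)) (LMul (LScale c a) b)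
  | LscaleAr c a b : leq_term (LScale c (LMul a b)) (LMul a (LScale c b))
  | Lvv v : leq_term (LMul (LVert v) (LVert v)) (LVert v)
  | Lvw v w : v != w -> leq_term (LMul (LVert v) (LVert w)) LZero
  | Lse e : leq_term (LMul (LVert (src e)) (LEdge e)) (LEdge e)
  | Ler e : leq_term (LMul (LEdge e) (LVert (rng e))) (LEdge e)
  | Lrg e : leq_term (LMul (LVert (rng e)) (LGhost e)) (LGhost e)
  | Lgs e : leq_term (LMul (LGhost e) (LVert (src e))) (LGhost e)
  | Lge e : leq_term (LMul (LGhost e) (LEdge e)) (LVert (rng e))
  | Lgf e f : e != f -> leq_term (LMul (LGhost e) (LEdge f)) LZero
  | Lck v : (exists e : edges E, src e = v) ->
      leq_term (LVert v)
        (LSum [seq LMul (LEdge e) (LGhost e) | e <- enum (edges E) & src e == v]).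

Lemma leq_term_equiv : equivrel leq_term.
Proof. by split; [exact: Lrefl | exact: Lsym | exact: Ltrans]. Qed.

Definition lpa : Type := quot leq_term.

Local Notation pi t := (cls leq_term t : lpa).

Lemma lpaP (a b : lterm) : pi a = pi b <-> leq_term a b.
Proof. exact: clsP leq_term_equiv. Qed.

Definition lpa_vert (v : vert E) : lpa := pi (LVert v).
Definition lpa_edge (e : edges E) : lpa := pi (LEdge e).
Definition lpa_ghost (e : edges E) : lpa := pi (LGhost e).
Definition lpa_zero : lpa := pi LZero.
Definition lpa_add (x y : lpa) : lpa := pi (LAdd (rep x) (rep y)).
Definition lpa_opp (x : lpa) : lpa := pi (LOpp (rep x)).
Definition lpa_scale (c : k) (x : lpa) : lpa := pi (LScale c (rep x)).
Definition lpa_mul (x y : lpa) : lpa := pi (LMul (rep x) (rep y)).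
(* The unit of the algebra of a finite graph is the sum of the vertices.      *)
Definition lpa_one : lpa := pi (LSum [seq LVert v | v <- enum (vert E)]).

Let repc a : leq_term (rep (pi a)) a.
Proof. exact: rep_cls leq_term_equiv. Qed.

Lemma lpa_addE a b : lpa_add (pi a) (pi b) = pi (LAdd a b).
Proof. by apply/lpaP; apply: Ladd_cong. Qed.
Lemma lpa_oppE a : lpa_opp (pi a) = pi (LOpp a).
Proof. by apply/lpaP; apply: Lopp_cong. Qed.
Lemma lpa_scaleE c a : lpa_scale c (pi a) = pi (LScale c a).
Proof. by apply/lpaP; apply: Lscale_cong. Qed.
Lemma lpa_mulE a b : lpa_mul (pi a) (pi b) = pi (LMul a b).
Proof. by apply/lpaP; apply: Lmul_cong. Qed.

Let lpaE := (lpa_addE, lpa_oppE, lpa_scaleE, lpa_mulE).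

Let lpa_ind1 (P : lpa -> Prop) : (forall a, P (pi a)) -> forall x, P x.
Proof. by move=> h x; rewrite -(repK x). Qed.

Let addA : associative lpa_add.
Proof.
elim/lpa_ind1=> a; elim/lpa_ind1=> b; elim/lpa_ind1=> c; rewrite !lpaE.
by apply/lpaP; apply: LaddA.
Qed.
Let addC : commutative lpa_add.
Proof.
elim/lpa_ind1=> a; elim/lpa_ind1=> b; rewrite !lpaE; apply/lpaP; exact: LaddC.
Qed.
Let add0 : left_id lpa_zero lpa_add.
Proof. by elim/lpa_ind1=> a; rewrite !lpaE; apply/lpaP; apply: Ladd0. Qed.
Let addN : left_inverse lpa_zero lpa_opp lpa_add.
Proof. by elim/lpa_ind1=> a; rewrite !lpaE; apply/lpaP; apply: LaddN. Qed.

HB.instance Definition _ := gen_eqMixin lpa.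
HB.instance Definition _ := gen_choiceMixin lpa.
HB.instance Definition _ := GRing.isZmodule.Build lpa addA addC add0 addN.

Let scaleA c d x : lpa_scale c (lpa_scale d x) = lpa_scale (c * d) x.
Proof.
by elim/lpa_ind1: x => a; rewrite !lpaE; apply/lpaP; apply: LscaleA.
Qed.
Let scale1 : left_id 1 lpa_scale.
Proof. by elim/lpa_ind1=> a; rewrite !lpaE; apply/lpaP; apply: Lscale1. Qed.
Let scaleDr : right_distributive lpa_scale +%R.
Proof.
move=> c; elim/lpa_ind1=> a; elim/lpa_ind1=> b.
by rewrite /GRing.add /= !lpaE; apply/lpaP; apply: LscaleDr.
Qed.
Let scaleDl x : {morph lpa_scale^~ x : c d / c + d}.
Proof.
move=> c d; elim/lpa_ind1: x => a.
by rewrite [RHS]/GRing.add /= !lpaE; apply/lpaP; apply: LscaleDl.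
Qed.

HB.instance Definition _ :=
  GRing.Zmodule_isLmodule.Build k lpa scaleA scale1 scaleDr scaleDl.

Let mulA : associative lpa_mul.
Proof.
elim/lpa_ind1=> a; elim/lpa_ind1=> b; elim/lpa_ind1=> c; rewrite !lpaE.
by apply/lpaP; apply: LmulA.
Qed.
Let mulDl : left_distributive lpa_mul +%R.
Proof.
elim/lpa_ind1=> a; elim/lpa_ind1=> b; elim/lpa_ind1=> c.
by rewrite /GRing.add /= !lpaE; apply/lpaP; apply: LmulDl.
Qed.
Let mulDr : right_distributive lpa_mul +%R.
Proof.
elim/lpa_ind1=> a; elim/lpa_ind1=> b; elim/lpa_ind1=> c.
by rewrite /GRing.add /= !lpaE; apply/lpaP; apply: LmulDr.
Qed.

Let scaleAl c x y : lpa_scale c (lpa_mul x y) = lpa_mul (lpa_scale c x) y.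
Proof.
elim/lpa_ind1: x => a; elim/lpa_ind1: y => b.
by rewrite !lpaE; apply/lpaP; apply: LscaleAl.
Qed.
Let scaleAr c x y : lpa_scale c (lpa_mul x y) = lpa_mul x (lpa_scale c y).
Proof.
elim/lpa_ind1: x => a; elim/lpa_ind1: y => b.
by rewrite !lpaE; apply/lpaP; apply: LscaleAr.
Qed.

Lemma lpa_sumE (s : seq lterm) : pi (LSum s) = \sum_(a <- s) pi a.
Proof.
elim: s => [|a s IHs]; first by rewrite big_nil.
by rewrite big_cons -IHs [RHS]/GRing.add /= lpaE.
Qed.

Let one_sum : lpa_one = \sum_v lpa_vert v.
Proof. by rewrite /lpa_one lpa_sumE big_map big_enum. Qed.

Let mul0 : left_zero 0 lpa_mul.
Proof. by move=> x; apply: (@addrI _ (lpa_mul 0 x)); rewrite -mulDl !addr0. Qed.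
Let mulr_0 : right_zero 0 lpa_mul.
Proof. by move=> x; apply: (@addrI _ (lpa_mul x 0)); rewrite -mulDr !addr0. Qed.

Let suml (I : Type) (r : seq I) (F : I -> lpa) x :
  lpa_mul (\sum_(i <- r) F i) x = \sum_(i <- r) lpa_mul (F i) x.
Proof. by apply: (big_morph (lpa_mul^~ x)) => [y z|]; rewrite (mulDl, mul0). Qed.
Let sumr (I : Type) (r : seq I) (F : I -> lpa) x :
  lpa_mul x (\sum_(i <- r) F i) = \sum_(i <- r) lpa_mul x (F i).
Proof. by apply: (big_morph (lpa_mul x)) => [y z|]; rewrite (mulDr, mulr_0). Qed.

Let vvE v w : lpa_mul (lpa_vert v) (lpa_vert w) = if v == w then lpa_vert v else 0.
Proof.
rewrite lpa_mulE; case: eqVneq => [<-|vw]; apply/lpaP; first exact: Lvv.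
exact: Lvw.
Qed.

Let onel v x : lpa_mul (lpa_vert v) x = x -> lpa_mul lpa_one x = x.
Proof.
move=> vx; rewrite -vx mulA one_sum suml (bigD1 v) //= vvE eqxx big1 ?addr0 //.
by move=> w /negPf wv; rewrite vvE wv.
Qed.
Let oner v x : lpa_mul x (lpa_vert v) = x -> lpa_mul x lpa_one = x.
Proof.
move=> vx; rewrite -vx -mulA one_sum sumr (bigD1 v) //= vvE eqxx big1 ?addr0 //.
by move=> w /negPf wv; rewrite vvE eq_sym wv.
Qed.

Let mul1 : left_id lpa_one lpa_mul.
Proof.
elim/lpa_ind1; elim=> [v|e|e||a IHa b IHb|a IHa|c a IHa|a IHa b IHb].
- by apply: (onel (v := v)); rewrite vvE eqxx.
- by apply: (onel (v := src e)); rewrite lpa_mulE; apply/lpaP/Lse.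
- by apply: (onel (v := rng e)); rewrite lpa_mulE; apply/lpaP/Lrg.
- exact: mulr_0.
- by rewrite -lpa_addE mulDr IHa IHb.
- rewrite -lpa_oppE; apply: (@addrI _ (lpa_mul lpa_one (pi a))).
  by rewrite -mulDr IHa [lpa_opp _]/(- (pi a)) subrr mulr_0.
- by rewrite -lpa_scaleE -scaleAr IHa.
- by rewrite -lpa_mulE mulA IHa.
Qed.

Let mulr_1 : right_id lpa_one lpa_mul.
Proof.
elim/lpa_ind1; elim=> [v|e|e||a IHa b IHb|a IHa|c a IHa|a IHa b IHb].
- by apply: (oner (v := v)); rewrite vvE eqxx.
- by apply: (oner (v := rng e)); rewrite lpa_mulE; apply/lpaP/Ler.
- by apply: (oner (v := src e)); rewrite lpa_mulE; apply/lpaP/Lgs.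
- exact: mul0.
- by rewrite -lpa_addE mulDl IHa IHb.
- rewrite -lpa_oppE; apply: (@addrI _ (lpa_mul (pi a) lpa_one)).
  by rewrite -mulDl IHa [lpa_opp _]/(- (pi a)) subrr mul0.
- by rewrite -lpa_scaleE -scaleAl IHa.
- by rewrite -lpa_mulE -mulA IHb.
Qed.

(* Only a pzRingType, and hence not an algType k: the algebra of the empty    *)
(* graph is 0.                                                                *)
HB.instance Definition _ :=
  GRing.Zmodule_isPzRing.Build lpa mulA mul1 mulr_1 mulDl mulDr.

Lemma lpa_scalerAl c (x y : lpa) : c *: (x * y) = (c *: x) * y.
Proof. exact: scaleAl. Qed.
Lemma lpa_scalerAr c (x y : lpa) : c *: (x * y) = x * (c *: y).
Proof. exact: scaleAr. Qed.
Lemma lpa_vvE v w : lpa_vert v * lpa_vert w = if v == w then lpa_vert v else 0.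
Proof. exact: vvE. Qed.

Inductive lpa_deg : int -> lpa -> Prop :=
  | Dvert v : lpa_deg 0 (lpa_vert v)
  | Dedge e : lpa_deg 1 (lpa_edge e)
  | Dghost e : lpa_deg (- 1) (lpa_ghost e)
  | Dzero n : lpa_deg n 0
  | Dadd n x y : lpa_deg n x -> lpa_deg n y -> lpa_deg n (x + y)
  | Dscale n c x : lpa_deg n x -> lpa_deg n (c *: x)
  | Dmul m n x y : lpa_deg m x -> lpa_deg n y -> lpa_deg (m + n) (x * y).

End LeavittPathAlgebra.

Record is_grading (V : zmodType) (deg : int -> V -> Prop) : Prop := IsGrading {
  deg_zero : forall n, deg n 0;
  deg_sub : forall n x y, deg n x -> deg n y -> deg n (x - y);
  deg_span : forall x, exists (s : seq int) (f : int -> V),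
    [/\ uniq s, forall n, deg n (f n) & x = \sum_(n <- s) f n];
  deg_indep : forall (s : seq int) (f : int -> V),
    uniq s -> (forall n, deg n (f n)) -> \sum_(n <- s) f n = 0 ->
    forall n, n \in s -> f n = 0
}.

Record grring := GrRing {
  gr_ring :> pzRingType;
  gr_deg : int -> gr_ring -> Prop;
  gr_grading : is_grading gr_deg;
  gr_mul : forall m n x y,
    gr_deg m x -> gr_deg n y -> gr_deg (m + n) (x * y)
}.

(* Right T-modules are left modules over the converse ring T^c.               *)
Definition rmul (T : pzRingType) (M : lmodType T^c) (x : M) (t : T) : M :=
  (t : T^c) *: x.

Record grmod (T : grring) := GrMod {
  gm_mod :> lmodType T^c;
  gm_deg : int -> gm_mod -> Prop;
  gm_grading : is_grading gm_deg;
  gm_rmul : forall m n (x : gm_mod) (t : T),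
    gm_deg m x -> gr_deg n t -> gm_deg (m + n) (rmul x t)
}.

Section GradingLemmas.

Variables (V : zmodType) (deg : int -> V -> Prop).
Hypothesis gr : is_grading deg.

Lemma deg_opp n x : deg n x -> deg n (- x).
Proof. by move=> xn; rewrite -sub0r; apply: (deg_sub gr) => //; apply: (deg_zero gr). Qed.

Lemma deg_add n x y : deg n x -> deg n y -> deg n (x + y).
Proof. by move=> xn yn; rewrite -[y]opprK; apply: (deg_sub gr) => //; apply: deg_opp. Qed.

Lemma sum_uniq_sub (s s' : seq int) (f : int -> V) :
  uniq s -> uniq s' -> {subset s <= s'} ->
  \sum_(n <- s) f n = \sum_(n <- s') (if n \in s then f n else 0).
Proof.
move=> us us' ss'; rewrite -big_mkcond -big_filter; apply: perm_big.
apply: uniq_perm => //; first exact: filter_uniq.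
by move=> n; rewrite mem_filter; case: (boolP (n \in s)) => // /ss' ->.
Qed.

(* The decomposition of x may be taken over any large enough set of degrees.  *)
Lemma deg_span_ext x : exists s0 : seq int, forall s : seq int,
  uniq s -> {subset s0 <= s} -> exists f : int -> V,
  (forall n, deg n (f n)) /\ x = \sum_(n <- s) f n.
Proof.
have [s0 [f [us0 fdeg ->]]] := deg_span gr x; exists s0 => s us ss.
exists (fun n => if n \in s0 then f n else 0); split; last exact: sum_uniq_sub.
by move=> n; case: ifP => // _; apply: (deg_zero gr).
Qed.

Lemma homog_part x n : exists y, deg n y /\
  exists (s : seq int) (f : int -> V),
    [/\ uniq s, n \in s, forall m, deg m (f m), f n = y & x = \sum_(m <- s) f m].
Proof.
have [s0 h] := deg_span_ext x.
have [||f [fdeg xE]] := h (undup (n :: s0)); first exact: undup_uniq.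
  by move=> m ms; rewrite mem_undup inE ms orbT.
exists (f n); split=> //; exists (undup (n :: s0)), f; split=> //.
- exact: undup_uniq.
- by rewrite mem_undup mem_head.
Qed.

Lemma homog_eq n y (s : seq int) (f : int -> V) :
  uniq s -> n \in s -> (forall m, deg m (f m)) -> deg n y ->
  y = \sum_(m <- s) f m -> y = f n.
Proof.
move=> us ns fdeg yn yE; apply/eqP; rewrite -subr_eq0 -opprB oppr_eq0.
pose g m := f m - (if m == n then y else 0).
have /(_ n ns) : forall m, m \in s -> g m = 0.
  apply: (deg_indep gr) => // [m|].
    rewrite /g; case: eqP => [->|_]; apply: (deg_sub gr) => //.
    exact: (deg_zero gr).
  rewrite sumrB -yE -big_mkcond /= (big_rem n) //= eqxx big_seq_cond big1 ?addr0 ?subrr //.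
  by move=> m /andP[]; rewrite mem_rem_uniq // inE => /andP[/negPf ->].
by rewrite /g eqxx => ->.
Qed.

End GradingLemmas.

Section GradedModules.

Variable T : grring.

Definition grhom (M N : grmod T) (f : {linear M -> N}) : Prop :=
  forall n x, gm_deg n x -> gm_deg n (f x).

Definition giso (M N : grmod T) : Prop := exists f : {linear M -> N},
  bijective f /\ forall n x, gm_deg n x <-> gm_deg n (f x).

Definition fg (M : grmod T) : Prop := exists (n : nat) (g : 'I_n -> M),
  forall x, exists c : 'I_n -> T, x = \sum_i rmul (g i) (c i).

Definition gr_projective (P : grmod T) : Prop :=
  forall (M N : grmod T) (p : {linear M -> N}) (g : {linear P -> N}),
    grhom p -> (forall y, exists x, p x = y) -> grhom g ->
    exists h : {linear P -> M}, grhom h /\ forall x, p (h x) = g x.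

Record fgproj := FGProj {
  fgp_mod :> grmod T;
  fgp_fg : fg fgp_mod;
  fgp_proj : gr_projective fgp_mod
}.

(* The shifted module M(j), with components M(j)_n = M_(n+j).                 *)
Section Shift.

Variables (M : grmod T) (j : int).
Let sdeg n (x : M) := gm_deg (n + j) x.

Let sgrading : is_grading sdeg.
Proof.
have gr := gm_grading M; split.
- by move=> n; apply: (deg_zero gr).
- by move=> n x y; apply: (deg_sub gr).
- move=> x; have [s [f [us fdeg xE]]] := deg_span gr x.
  exists [seq n - j | n <- s], (fun n => f (n + j)); split.
  + by rewrite map_inj_uniq //; apply: addIr.
  + by move=> n; apply: fdeg.
  + by rewrite big_map xE; apply: eq_bigr => n _; rewrite subrK.
- move=> s f us fdeg s0 n ns.
  have := deg_indep gr (s := [seq m + j | m <- s]) (f := fun m => f (m - j)).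
  rewrite map_inj_uniq ?us; last exact: addIr.
  move=> /(_ isT) h; rewrite -[n](addrK j); apply: h.
  + by move=> m; rewrite -{1}[m](subrK j); apply: fdeg.
  + by rewrite big_map -[RHS]s0; apply: eq_bigr => m _; rewrite addrK.
  + exact: map_f.
Qed.

Let srmul m n (x : M) (t : T) :
  sdeg m x -> gr_deg n t -> sdeg (m + n) (rmul x t).
Proof. by move=> xm tn; rewrite /sdeg addrAC; apply: gm_rmul. Qed.

Definition gshift : grmod T := GrMod sgrading srmul.

End Shift.

Lemma gshift_proj (P : grmod T) j : gr_projective P -> gr_projective (gshift P j).
Proof.
move=> pP M N p g pdeg psurj gdeg.
have [||h [hdeg hE]] := pP (gshift M (- j)) (gshift N (- j)) p g _ psurj.
- by move=> n x; apply: pdeg.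
- by move=> n x xn; apply: gdeg; rewrite /= subrK.
by exists h; split=> // n x /hdeg /=; rewrite addrK.
Qed.

Definition fgp_shift (P : fgproj) : fgproj :=
  @FGProj (gshift P 1) (fgp_fg P) (gshift_proj (fgp_proj (f := P))).

Section DirectSum.

Variables (M N : grmod T).
Let ddeg n (x : (M * N)%type) := gm_deg n x.1 /\ gm_deg n x.2.

Let fst_sum (s : seq int) (f : int -> (M * N)%type) :
  (\sum_(n <- s) f n).1 = \sum_(n <- s) (f n).1.
Proof. by apply: (big_morph (fun x : M * N => x.1)). Qed.
Let snd_sum (s : seq int) (f : int -> (M * N)%type) :
  (\sum_(n <- s) f n).2 = \sum_(n <- s) (f n).2.
Proof. by apply: (big_morph (fun x : M * N => x.2)). Qed.

Let dgrading : is_grading ddeg.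
Proof.
have gM := gm_grading M; have gN := gm_grading N; split.
- by move=> n; split; apply: deg_zero.
- by move=> n x y [x1 x2] [y1 y2]; split; apply: deg_sub.
- move=> x; have [s1 h1] := deg_span_ext gM x.1.
  have [s2 h2] := deg_span_ext gN x.2; pose s := undup (s1 ++ s2).
  have us : uniq s by apply: undup_uniq.
  have [|f [fdeg fE]] := h1 s us.
    by move=> n n1; rewrite mem_undup mem_cat n1.
  have [|g [gdeg gE]] := h2 s us.
    by move=> n n2; rewrite mem_undup mem_cat n2 orbT.
  exists s, (fun n => (f n, g n)); split=> //.
  by rewrite [LHS]surjective_pairing [RHS]surjective_pairing fst_sum snd_sum fE gE.
- move=> s f us fdeg s0 n ns.
  rewrite [LHS]surjective_pairing; congr pair.
  + apply: (deg_indep gM us (f := fun m => (f m).1)) => // [m|].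
      by case: (fdeg m).
    by rewrite -fst_sum s0.
  + apply: (deg_indep gN us (f := fun m => (f m).2)) => // [m|].
      by case: (fdeg m).
    by rewrite -snd_sum s0.
Qed.

Let drmul m n (x : (M * N)%type) (t : T) :
  ddeg m x -> gr_deg n t -> ddeg (m + n) (rmul x t).
Proof. by move=> [x1 x2] tn; split; apply: gm_rmul. Qed.

Definition gsum : grmod T := GrMod dgrading drmul.

Lemma gsum_fg : fg M -> fg N -> fg gsum.
Proof.
move=> [m [g gE]] [n [h hE]].
exists (m + n)%N, (fun i => match split i with
  inl i1 => (g i1, 0) : gsum | inr i2 => (0, h i2) : gsum end) => -[x y].
have [c cE] := gE x; have [d dE] := hE y.
exists (fun i => match split i with inl i1 => c i1 | inr i2 => d i2 end).
rewrite big_split_ord /= [RHS]surjective_pairing; congr pair.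
- rewrite [RHS]/= !(big_morph (fun x : M * N => x.1) (id1 := 0) (op1 := +%R)) //.
  rewrite [X in _ + X]big1 ?addr0 => [|i _]; last first.
    by rewrite -[rshift _ _]/(unsplit (inr i)) unsplitK /= scaler0.
  rewrite cE; apply: eq_bigr => i _.
  by rewrite -[lshift _ _]/(unsplit (inl i)) unsplitK.
- rewrite [RHS]/= !(big_morph (fun x : M * N => x.2) (id1 := 0) (op1 := +%R)) //.
  rewrite [X in X + _]big1 ?add0r => [|i _]; last first.
    by rewrite -[lshift _ _]/(unsplit (inl i)) unsplitK /= scaler0.
  rewrite dE; apply: eq_bigr => i _.
  by rewrite -[rshift _ _]/(unsplit (inr i)) unsplitK.
Qed.

Lemma gsum_proj : gr_projective M -> gr_projective N -> gr_projective gsum.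
Proof.
move=> pM pN X Y p g pdeg psurj gdeg.
pose g1 (x : M) := g ((x, 0) : gsum); pose g2 (y : N) := g ((0, y) : gsum).
have g1L : linear g1.
  move=> c x y; rewrite /g1 -linearP; congr (g _).
  by rewrite [RHS]surjective_pairing /=; congr pair; rewrite scaler0 addr0.
have g2L : linear g2.
  move=> c x y; rewrite /g2 -linearP; congr (g _).
  by rewrite [RHS]surjective_pairing /=; congr pair; rewrite scaler0 addr0.
pose g1' : {linear M -> Y} := HB.pack g1 (GRing.isLinear.Build _ _ _ _ _ g1L).
pose g2' : {linear N -> Y} := HB.pack g2 (GRing.isLinear.Build _ _ _ _ _ g2L).
have [//|//||h1 [d1 e1]] := pM X Y p g1'.
  by move=> n x xn; apply: gdeg; split=> //; apply: deg_zero (gm_grading N) _.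
have [//|//||h2 [d2 e2]] := pN X Y p g2'.
  by move=> n x xn; apply: gdeg; split=> //; apply: deg_zero (gm_grading M) _.
pose h (x : gsum) := h1 x.1 + h2 x.2.
have hL : linear h.
  by move=> c x y; rewrite /h /= !linearP scalerDr addrACA.
exists (HB.pack h (GRing.isLinear.Build _ _ _ _ _ hL) : {linear gsum -> X}).
split=> [n x [x1 x2]|x] /=.
  by apply: (deg_add (gm_grading X)); [apply: d1 | apply: d2].
rewrite /h linearD e1 e2 /= /g1 /g2 -linearD; congr (g _).
by rewrite [LHS]surjective_pairing [RHS]surjective_pairing /= addr0 add0r.
Qed.

End DirectSum.

Definition fgp_sum (P Q : fgproj) : fgproj := @FGProj (gsum P Q)
  (gsum_fg (fgp_fg P) (fgp_fg Q)) (gsum_proj (fgp_proj (f := P)) (fgp_proj (f := Q))).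

Section ZeroModule.

Let Z : lmodType T^c := 'rV[T^c]_0.
Let zdeg (n : int) (x : Z) := True.

Let z0 (x y : Z) : x = y. Proof. by rewrite [x]thinmx0 [y]thinmx0. Qed.

Let zgrading : is_grading zdeg.
Proof.
split=> // x.
by exists [::], (fun=> 0); split=> //; apply: z0.
Qed.

Let zrmul m n (x : Z) (t : T) : zdeg m x -> gr_deg n t -> zdeg (m + n) (rmul x t).
Proof. by []. Qed.

Definition gzero : grmod T := GrMod zgrading zrmul.

Lemma gzero_fg : fg gzero.
Proof. by exists 0%N, (fun=> 0) => x; exists (fun=> 0); apply: z0. Qed.

Lemma gzero_proj : gr_projective gzero.
Proof.
move=> M N p g _ _ _; exists (\0 : {linear gzero -> M}); split=> [n x _|x] /=.
  exact: deg_zero (gm_grading M) _.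
by rewrite linear0 (z0 x 0) linear0.
Qed.

Definition fgp_zero : fgproj := FGProj gzero_fg gzero_proj.

End ZeroModule.

Definition fgp_iso (P Q : fgproj) : Prop := giso P Q.

Lemma fgp_iso_equiv : equivrel fgp_iso.
Proof.
split.
- by move=> P; exists (idfun : {linear P -> P}); split=> //; exists idfun.
- move=> P Q [f [[g fK gK] fdeg]].
  have gL : linear g by move=> c x y; apply: (can_inj fK); rewrite linearP !gK.
  exists (HB.pack g (GRing.isLinear.Build _ _ _ _ _ gL) : {linear Q -> P}).
  by split=> [|n x]; [exists f | rewrite fdeg /= gK].
- move=> P Q X [f [fbij fdeg]] [g [gbij gdeg]].
  exists (g \o f : {linear P -> X}); split; first exact: bij_comp.
  by move=> n x; rewrite fdeg gdeg.
Qed.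

Lemma fgp_sum_iso P P' Q Q' :
  fgp_iso P P' -> fgp_iso Q Q' -> fgp_iso (fgp_sum P Q) (fgp_sum P' Q').
Proof.
move=> [f [[f' fK f'K] fdeg]] [g [[g' gK g'K] gdeg]].
pose h (x : fgp_sum P Q) : fgp_sum P' Q' := (f x.1, g x.2).
have hL : linear h.
  by move=> c x y; rewrite /h !linearP.
exists (HB.pack h (GRing.isLinear.Build _ _ _ _ _ hL)
        : {linear fgp_sum P Q -> fgp_sum P' Q'}); split.
  exists (fun x => (f' x.1, g' x.2)) => -[x y]; rewrite /= /h /=.
    by rewrite fK gK.
  by rewrite f'K g'K.
by move=> n [x y] /=; split=> -[xn yn]; split; move: xn yn; rewrite /= ?fdeg ?gdeg.
Qed.

Lemma fgp_sumC P Q : fgp_iso (fgp_sum P Q) (fgp_sum Q P).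
Proof.
pose h (x : fgp_sum P Q) : fgp_sum Q P := (x.2, x.1).
have hL : linear h by [].
exists (HB.pack h (GRing.isLinear.Build _ _ _ _ _ hL)
        : {linear fgp_sum P Q -> fgp_sum Q P}); split.
  by exists (fun x => (x.2, x.1)) => -[].
by move=> n [x y]; split=> -[].
Qed.

Lemma fgp_sumA P Q X :
  fgp_iso (fgp_sum P (fgp_sum Q X)) (fgp_sum (fgp_sum P Q) X).
Proof.
pose h (x : fgp_sum P (fgp_sum Q X)) : fgp_sum (fgp_sum P Q) X :=
  ((x.1, x.2.1), x.2.2).
have hL : linear h by [].
exists (HB.pack h (GRing.isLinear.Build _ _ _ _ _ hL)
        : {linear fgp_sum P (fgp_sum Q X) -> fgp_sum (fgp_sum P Q) X}); split.
  by exists (fun x => (x.1.1, (x.1.2, x.2))) => [[x [y z]]|[[x y] z]].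
by move=> n [x [y z]]; split=> [[? []]|[[]]].
Qed.

(* The monoid of graded isomorphism classes, and its group completion.        *)
Definition vgr : Type := quot fgp_iso.
Definition vgr_class (P : fgproj) : vgr := cls fgp_iso P.
Definition vgr_add (a b : vgr) : vgr := vgr_class (fgp_sum (rep a) (rep b)).
Definition vgr_shift (a : vgr) : vgr := vgr_class (fgp_shift (rep a)).

Definition k0_rel (a b : vgr * vgr) : Prop := exists c,
  vgr_add (vgr_add a.1 b.2) c = vgr_add (vgr_add b.1 a.2) c.

Definition K0gr : Type := quot k0_rel.
Definition K0_class (P : fgproj) : K0gr :=
  cls k0_rel (vgr_class P, vgr_class fgp_zero).
Definition K0_add (a b : K0gr) : K0gr :=
  cls k0_rel (vgr_add (rep a).1 (rep b).1, vgr_add (rep a).2 (rep b).2).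
Definition K0_shift (a : K0gr) : K0gr :=
  cls k0_rel (vgr_shift (rep a).1, vgr_shift (rep a).2).
Definition K0_pos (a : K0gr) : Prop := exists P, a = K0_class P.

Lemma vgr_addE P Q : vgr_add (vgr_class P) (vgr_class Q) = vgr_class (fgp_sum P Q).
Proof.
by apply/(clsP _ _ fgp_iso_equiv)/fgp_sum_iso; apply: rep_cls fgp_iso_equiv.
Qed.

Lemma vgr_addC : commutative vgr_add.
Proof. by move=> a b; apply/(clsP _ _ fgp_iso_equiv)/fgp_sumC. Qed.

Lemma vgr_addA : associative vgr_add.
Proof.
move=> a b c; rewrite -(repK a) -(repK b) -(repK c) -!/(vgr_class _) !vgr_addE.
by apply/(clsP _ _ fgp_iso_equiv)/fgp_sumA.
Qed.

Lemma k0_rel_equiv : equivrel k0_rel.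
Proof.
have addCA : left_commutative vgr_add.
  by move=> a b c; rewrite !vgr_addA (vgr_addC a).
have addACA : interchange vgr_add vgr_add.
  by move=> a b c d; rewrite -!vgr_addA (addCA b).
split=> [a|a b [c ?]|[a a'] [b b'] [c c'] /= [d abE] [e bcE]].
- by exists (vgr_class fgp_zero).
- by exists c.
exists (vgr_add (vgr_add b' d) (vgr_add b e)) => /=.
rewrite addACA (addCA c') !vgr_addA abE -!vgr_addA (vgr_addA b c') bcE.
rewrite -!vgr_addA (addCA b a') (addCA c a'); congr vgr_add.
by rewrite (addCA d c) (addCA b c) (addCA d b') (addCA b b') (addCA b d).
Qed.

End GradedModules.

Section LeavittGrading.

Variables (k : fieldType) (E : graph).
Local Notation L := (lpa k E).
Local Notation pi t := (cls (@leq_term k E) t : L).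

Lemma lpa_Ladd a b : (pi (LAdd a b)) = (pi a) + (pi b).
Proof. by rewrite -lpa_addE. Qed.
Lemma lpa_Lopp a : (pi (LOpp a)) = - (pi a).
Proof. by rewrite -lpa_oppE. Qed.
Lemma lpa_Lscale c a : (pi (LScale c a)) = c *: (pi a).
Proof. by rewrite -lpa_scaleE. Qed.
Lemma lpa_Lmul a b : (pi (LMul a b)) = (pi a) * (pi b).
Proof. by rewrite -lpa_mulE. Qed.

(* L acts on the functions int -> L, homogeneous elements of degree d shifting*)
(* the argument by d; this separates the homogeneous components of L.         *)
Let V := int -> L.
Fixpoint shift_act (t : lterm k E) (f : V) : V :=
  match t with
  | LVert v => fun n => lpa_vert k v * f n
  | LEdge e => fun n => lpa_edge k e * f (n - 1)
  | LGhost e => fun n => lpa_ghost k e * f (n + 1)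
  | LZero => fun=> 0
  | LAdd a b => fun n => shift_act a f n + shift_act b f n
  | LOpp a => fun n => - shift_act a f n
  | LScale c a => fun n => c *: shift_act a f n
  | LMul a b => shift_act a (shift_act b f)
  end.

Let act_add t f g :
  shift_act t (fun n => f n + g n) = fun n => shift_act t f n + shift_act t g n.
Proof.
apply: funext; elim: t f g => //= [v|e|e||a IHa b IHb|a IHa|c a IHa|a IHa b IHb] f g n;
  rewrite ?mulrDr ?addr0 ?IHa ?IHb ?opprD ?scalerDr //.
- by rewrite addrACA.
- by rewrite -IHa; congr (shift_act a _ n); apply: funext.
Qed.

Let act_scale t c f :
  shift_act t (fun n => c *: f n) = fun n => c *: shift_act t f n.
Proof.
apply: funext; elim: t f => //= [v|e|e||a IHa b IHb|a IHa|d a IHa|a IHa b IHb] f n;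
  rewrite ?lpa_scalerAr ?scaler0 ?IHa ?IHb ?scalerDr ?scalerN //.
- by rewrite !scalerA mulrC.
- by rewrite -IHa; congr (shift_act a _ n); apply: funext.
Qed.

Let act_zero t : shift_act t (fun=> 0) = fun=> 0.
Proof.
apply: funext; elim: t => //= [v|e|e|a IHa b IHb|a IHa|d a IHa|a IHa b IHb] n;
  rewrite ?mulr0 ?IHa ?IHb ?addr0 ?oppr0 ?scaler0 //.
by rewrite (_ : shift_act b _ = fun=> 0) ?IHa //; apply: funext.
Qed.

Let act_sum (s : seq (lterm k E)) f n :
  shift_act (LSum s) f n = \sum_(a <- s) shift_act a f n.
Proof. by elim: s => [|a s IHs] /=; rewrite ?big_nil ?big_cons ?IHs. Qed.

Let act_rel a b : leq_term a b -> shift_act a = shift_act b.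
Proof.
move=> ab; apply: funext => f; elim: ab f => //=.
- by move=> ? ? ? _ h1 _ h2 f; rewrite h1 h2.
- by move=> ? ? ? ? _ h1 _ h2 f; rewrite h1 h2.
- by move=> ? ? _ h f; rewrite h.
- by move=> ? ? ? _ h f; rewrite h.
- by move=> ? ? ? ? _ h1 _ h2 f; rewrite h1 h2.
- by move=> *; apply: funext => n; rewrite addrA.
- by move=> *; apply: funext => n; rewrite addrC.
- by move=> *; apply: funext => n; rewrite add0r.
- by move=> *; apply: funext => n; rewrite addNr.
- by move=> *; apply: funext => n; rewrite scalerA.
- by move=> *; apply: funext => n; rewrite scale1r.
- by move=> *; apply: funext => n; rewrite scalerDr.
- by move=> *; apply: funext => n; rewrite scalerDl.
- by move=> v f; apply: funext => n; rewrite mulrA lpa_vvE eqxx.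
- by move=> v w /negPf vw f; apply: funext => n; rewrite mulrA lpa_vvE vw mul0r.
- move=> e f; apply: funext => n; rewrite mulrA; congr (_ * _).
  by rewrite -lpa_Lmul; apply/lpaP/Lse.
- move=> e f; apply: funext => n; rewrite mulrA; congr (_ * _).
  by rewrite -lpa_Lmul; apply/lpaP/Ler.
- move=> e f; apply: funext => n; rewrite mulrA; congr (_ * _).
  by rewrite -lpa_Lmul; apply/lpaP/Lrg.
- move=> e f; apply: funext => n; rewrite mulrA; congr (_ * _).
  by rewrite -lpa_Lmul; apply/lpaP/Lgs.
- move=> e f; apply: funext => n; rewrite mulrA addrK; congr (_ * _).
  by rewrite -lpa_Lmul; apply/lpaP/Lge.
- move=> e e' ee' f; apply: funext => n; rewrite mulrA addrK.
  suff -> : lpa_ghost k e * lpa_edge k e' = 0 by rewrite mul0r.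
  by rewrite -lpa_Lmul; apply/lpaP/Lgf.
- move=> v ve f; apply: funext => n; rewrite act_sum big_map.
  have -> : lpa_vert k v =
      \sum_(e <- enum (edges E) | src e == v) lpa_edge k e * lpa_ghost k e.
    rewrite /lpa_vert; have /lpaP -> := @Lck k E v ve.
    rewrite lpa_sumE big_map big_filter; apply: eq_bigr => e _.
    exact: lpa_Lmul.
  rewrite big_filter mulr_suml; apply: eq_bigr => e _ /=.
  by rewrite subrK mulrA.
Qed.

Let act (x : L) := shift_act (rep x).
Let actE t : act (pi t) = shift_act t.
Proof. by apply: act_rel; apply: rep_cls (@leq_term_equiv k E). Qed.

Let lpa_rep (x : L) : exists t, x = (pi t).
Proof. by exists (rep x); rewrite repK. Qed.

Let actD x y f n : act (x + y) f n = act x f n + act y f n.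
Proof.
by have [a ->] := lpa_rep x; have [b ->] := lpa_rep y; rewrite -lpa_Ladd !actE.
Qed.

Let act_homog d x : lpa_deg d x -> forall f n, act x f n = x * f (n - d).
Proof.
elim=> {d x} [v|e|e|d|d x y _ IHx _ IHy|d c x _ IHx|d d' x y _ IHx _ IHy] f n.
- by rewrite actE subr0.
- by rewrite actE.
- by rewrite actE opprK.
- by rewrite (actE (LZero k E)) mul0r.
- by rewrite actD IHx IHy mulrDl.
- have [a xE] := lpa_rep x; rewrite xE -lpa_Lscale actE /= -actE -xE IHx.
  by rewrite lpa_Lscale -xE lpa_scalerAl.
- have [a xE] := lpa_rep x; have [b yE] := lpa_rep y.
  rewrite {1}xE {1}yE -lpa_Lmul actE /= -!actE -xE -yE IHx IHy.
  by rewrite -mulrA opprD addrA.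
Qed.

Let act_sumr (s : seq int) (x : int -> L) f n :
  act (\sum_(d <- s) x d) f n = \sum_(d <- s) act (x d) f n.
Proof.
elim: s => [|d s IHs]; rewrite ?big_nil ?big_cons ?actD ?IHs //.
by rewrite (actE (LZero k E)).
Qed.

Let deg_sums x : exists s : seq (int * L),
  (forall p, p \in s -> lpa_deg p.1 p.2) /\ x = \sum_(p <- s) p.2.
Proof.
have one d y : lpa_deg d y -> exists s : seq (int * L),
    (forall p, p \in s -> lpa_deg p.1 p.2) /\ y = \sum_(p <- s) p.2.
  move=> dy; exists [:: (d, y)]; split; last by rewrite big_seq1.
  by move=> p; rewrite inE => /eqP ->.
have scl c s : (forall p, p \in s -> lpa_deg p.1 p.2) ->
    exists s' : seq (int * L), (forall p, p \in s' -> lpa_deg p.1 p.2) /\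
      c *: (\sum_(p <- s) p.2) = \sum_(p <- s') p.2.
  move=> sP; exists [seq (p.1, c *: p.2) | p <- s]; split.
    by move=> _ /mapP[p ps ->] /=; apply: Dscale; apply: sP.
  by rewrite big_map scaler_sumr.
have [t ->] := lpa_rep x; elim: t {x} => [v|e|e||a IHa b IHb|a IHa|c a IHa|a IHa b IHb].
- by apply: (one 0); apply: Dvert.
- by apply: (one 1); apply: Dedge.
- by apply: (one (- 1)); apply: Dghost.
- by apply: (one 0); apply: (Dzero k E 0).
- have [s [sP sE]] := IHa; have [u [uP uE]] := IHb.
  exists (s ++ u); rewrite lpa_Ladd sE uE big_cat; split=> // p.
  by rewrite mem_cat => /orP[/sP|/uP].
- have [s [/(scl (- 1))[s' [s'P s'E]] sE]] := IHa.
  by exists s'; rewrite lpa_Lopp sE -s'E scaleN1r.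
- have [s [/(scl c)[s' [s'P s'E]] sE]] := IHa.
  by exists s'; rewrite lpa_Lscale sE -s'E.
- have [s [sP sE]] := IHa; have [u [uP uE]] := IHb.
  exists [seq (p.1 + q.1, p.2 * q.2) | p <- s, q <- u]; split.
    by move=> _ /allpairsP[[p q] [/sP ps /uP qu ->]] /=; apply: Dmul.
  rewrite lpa_Lmul sE uE big_allpairs_dep mulr_suml; apply: eq_bigr => p _.
  by rewrite mulr_sumr.
Qed.

Lemma lpa_grading : is_grading (@lpa_deg k E).
Proof.
split.
- exact: Dzero.
- by move=> n x y xn yn; rewrite -scaleN1r; apply: Dadd => //; apply: Dscale.
- move=> x; have [s [sP ->]] := deg_sums x.
  exists (undup [seq p.1 | p <- s]), (fun n => \sum_(p <- s | p.1 == n) p.2).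
  split; first exact: undup_uniq.
    move=> n; rewrite big_seq_cond; elim/big_rec: _ => [|p y /andP[/sP ps /eqP pn] yn].
      exact: Dzero.
    by apply: Dadd => //; rewrite -pn.
  rewrite (exchange_big_dep xpredT) //= big_seq [RHS]big_seq; apply: eq_bigr => p ps.
  rewrite -big_filter (eq_filter (a2 := pred1 p.1)); last by move=> n; rewrite /= eq_sym.
  rewrite filter_pred1_uniq ?undup_uniq ?mem_undup ?map_f //.
  by rewrite big_seq1.
- move=> s x us xdeg x0 n ns.
  have /(congr1 (fun y => act y (fun m => if m == 0 then 1 else 0) n)) := x0.
  rewrite act_sumr (actE (LZero k E)) /= (bigD1_seq n) //= (act_homog (xdeg n)).
  rewrite subrr eqxx mulr1 big1 ?addr0 // => m /negPf mn.
  by rewrite (act_homog (xdeg m)) subr_eq0 eq_sym mn mulr0.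
Qed.

Lemma lpa_one_deg : lpa_deg 0 (1 : L).
Proof.
rewrite [1]lpa_sumE big_map; elim/big_rec: _ => [|v x _ x0]; first exact: Dzero.
by apply: Dadd => //; apply: Dvert.
Qed.

Definition lpa_gr : grring := GrRing lpa_grading (@Dmul k E).

(* The right ideal v L_k(E) = {x | v x = x}.                                  *)
Section VertexModule.

Variable v : vert E.

Definition vL_pred : {pred (L^c)^o} := [pred x | (lpa_vert k v * (x : L) : L) == x].

Let vL_closed : submod_closed vL_pred.
Proof.
split=> [|a x y /eqP xv /eqP yv]; first by apply/eqP; rewrite mulr0.
apply/eqP; have -> : a *: x + y = ((x : L) * (a : L) + y : L) by [].
by rewrite mulrDr mulrA xv yv.
Qed.

HB.instance Definition _ := GRing.isSubmodClosed.Build _ _ vL_pred vL_closed.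

Record vL := VL { vLval :> (L^c)^o; vLP : vLval \in vL_pred }.
HB.instance Definition _ := [isSub for vLval].
HB.instance Definition _ := [Choice of vL by <:].
HB.instance Definition _ := [SubChoice_isSubLmodule of vL by <:].

Let vdeg n (x : vL) : Prop := lpa_deg n (val x : L).

Let vleft (x : L) : lpa_vert k v * x \in vL_pred.
Proof. by apply/eqP; rewrite mulrA lpa_vvE eqxx. Qed.

Let vmul (x : L) : vL := VL (vleft x).

Let vmul_id (x : vL) : vmul (val x) = x.
Proof. by apply: val_inj; apply/eqP; exact: (vLP x). Qed.

Let vgrading : is_grading vdeg.
Proof.
have gr := lpa_grading; split.
- by move=> n; apply: (deg_zero gr).
- by move=> n x y; apply: (deg_sub gr).
- move=> x; have [s [f [us fdeg xE]]] := deg_span gr (val x : L).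
  exists s, (fun n => vmul (f n)); split=> // [n|].
    by rewrite /vdeg /= -{1}[n]add0r; apply: Dmul => //; apply: Dvert.
  apply: val_inj; rewrite raddf_sum /=.
  transitivity (lpa_vert k v * (\sum_(n <- s) f n) : L).
    by rewrite -xE; apply/esym; apply/eqP; exact: (vLP x).
  by rewrite mulr_sumr.
- move=> s f us fdeg s0 n ns; apply: val_inj.
  apply: (deg_indep gr (f := fun m => val (f m) : L)) us _ _ n ns => //.
  by have := congr1 val s0; rewrite raddf_sum.
Qed.

Let vrmul m n (x : vL) (t : L) :
  vdeg m x -> lpa_deg n t -> vdeg (m + n) (rmul x t).
Proof. exact: Dmul. Qed.

Definition vL_gr : grmod lpa_gr := @GrMod lpa_gr vL vdeg vgrading vrmul.

Let vunit : vL := vmul 1.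

Let vunitE (x : vL) : rmul vunit (val x) = x.
Proof.
apply: val_inj; transitivity (lpa_vert k v * 1 * (val x : L) : L) => //.
by rewrite mulr1; apply/eqP; exact: (vLP x).
Qed.

Lemma vL_fg : fg vL_gr.
Proof.
exists 1%N, (fun=> vunit) => x; exists (fun=> val x : L).
by rewrite big_ord1 vunitE.
Qed.

Lemma vL_proj : gr_projective vL_gr.
Proof.
move=> M N p g pdeg psurj gdeg; have [m0 m0E] := psurj (g vunit).
have [y [y0 [s [f [us s0 fdeg fy m0s]]]]] := homog_part (gm_grading M) m0 0.
have gy : g vunit = p y.
  rewrite -fy; apply: (homog_eq (gm_grading N) (s := s) (f := p \o f)) => //.
  - by move=> m; apply: pdeg.
  - apply: gdeg; rewrite /= /vdeg /= -[0]addr0; apply: Dmul; first exact: Dvert.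
    exact: lpa_one_deg.
  - by rewrite -m0E m0s raddf_sum.
pose h (x : vL) : M := ((val x : L) : L^c) *: y.
have hL : linear h by move=> a x x'; rewrite /h scalerA -scalerDl.
exists (HB.pack h (GRing.isLinear.Build _ _ _ _ _ hL) : {linear vL_gr -> M}).
split=> [n x xn|x] /=; first by rewrite -[n]add0r; apply: gm_rmul.
by rewrite /h linearZ /= -gy -[in RHS](vunitE x) /rmul linearZ.
Qed.

Definition vL_fgp : fgproj lpa_gr := FGProj vL_fg vL_proj.

End VertexModule.

End LeavittGrading.

(* b : M x N -> P exhibits the abelian group P as the tensor product of M and *)
(* N over T, where T acts on the right of M by ra and on the left of N by la. *)
Section TensorProduct.

Variables (T : Type) (M N : zmodType) (ra : M -> T -> M) (la : T -> N -> N).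

Definition balanced (P : zmodType) (b : M -> N -> P) : Prop :=
  [/\ forall x x' y, b (x + x') y = b x y + b x' y,
      forall x y y', b x (y + y') = b x y + b x y'
    & forall x t y, b (ra x t) y = b x (la t y)].

Definition is_tensor (P : zmodType) (b : M -> N -> P) : Prop :=
  balanced b /\
  forall (Q : zmodType) (g : M -> N -> Q), balanced g ->
    exists h : {additive P -> Q},
      (forall x y, h (b x y) = g x y) /\
      forall h' : {additive P -> Q},
        (forall x y, h' (b x y) = g x y) -> h' =1 h.

End TensorProduct.

Section InducedMap.

Variables (T T' : grring) (xi : {rmorphism T -> T'}).

(* Y, with x (x) t := b x t, is the graded right T'-module X (x)_xi T'.       *)
Definition is_gr_extension (X : grmod T) (Y : grmod T') (b : X -> T' -> Y) : Prop :=
  [/\ is_tensor (@rmul T X) (fun (t : T) (t' : T') => xi t * t') b,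
      forall x t s, b x (t * s) = rmul (b x t) s
    & forall m n x t, gm_deg m x -> gr_deg n t -> gm_deg (m + n) (b x t)].

(* f is the map [X] |-> [X (x)_xi T'] induced by xi. Tensor products being      *)
(* unique up to isomorphism, this determines f.                               *)
Definition is_K0_map (f : K0gr T -> K0gr T') : Prop :=
  (forall a b, f (K0_add a b) = K0_add (f a) (f b)) /\
  forall X : fgproj T, exists (Y : fgproj T') (b : X -> T' -> Y),
    is_gr_extension b /\ f (K0_class X) = K0_class Y.

End InducedMap.

Definition natmx (R : pzRingType) (m n : nat) (A : 'M[nat]_(m, n)) : 'M[R]_(m, n) :=
  map_mx (fun a : nat => a%:R) A.

Section DimensionData.

Variables (n : nat) (A : 'M[nat]_n).
Local Notation Az := (natmx int A).
Local Notation Aq := (natmx rat A).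

Definition dimG_rel (p q : 'cV[int]_n * nat) : Prop :=
  exists m, [/\ (p.2 <= m)%N, (q.2 <= m)%N &
    Az^T ^+ (m - p.2) *m p.1 = Az^T ^+ (m - q.2) *m q.1].

Definition dimG : Type := quot dimG_rel.
Definition dimG_class (v : 'cV[int]_n) (l : nat) : dimG := cls dimG_rel (v, l).
Definition dimG_add (a b : dimG) : dimG :=
  let: (v, l) := rep a in let: (w, l') := rep b in
  dimG_class (Az^T ^+ l' *m v + Az^T ^+ l *m w) (l + l')%N.
Definition dimG_x (a : dimG) : dimG :=
  let: (v, l) := rep a in dimG_class (Az^T *m v) l.
Definition dimG_pos (a : dimG) : Prop :=
  exists (v : 'cV[int]_n) (l : nat), (forall i, 0 <= v i 0) /\ a = dimG_class v l.
Definition dimG_unit : dimG := dimG_class (const_mx 1) 0.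

Record Delta := MkDelta {
  dvec :> 'rV[rat]_n;
  dvec_range : forall l, (1 <= l)%N -> exists u : 'rV[rat]_n, dvec = u *m Aq ^+ l;
  dvec_int : exists l, dvec *m Aq ^+ l \is a mxOver Num.int
}.

(* [(A^t)^l v^t, l] for the least l such that v A^l is integral; other such l *)
(* give the same class.                                                       *)
Definition psi (v : Delta) : dimG :=
  let l := ex_minn (dvec_int v) in
  dimG_class (map_mx Num.floor (v *m Aq ^+ l))^T l.

Definition is_order_unit (u : Delta) : Prop := psi u = dimG_unit.

End DimensionData.

(* The map v |-> v R between the dimension groups of A and B, as a graph.     *)
Definition dim_map (m n : nat) (A : 'M[nat]_m) (B : 'M[nat]_n)
    (R : 'M[nat]_(m, n)) (v : Delta A) (w : Delta B) : Prop :=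
  dvec w = v *m natmx rat R.

Definition unital_dim_map (m n : nat) (A : 'M[nat]_m) (B : 'M[nat]_n)
    (R : 'M[nat]_(m, n)) : Prop :=
  exists (u : Delta A) (w : Delta B),
    [/\ is_order_unit u, is_order_unit w & dim_map R u w].

Section LeavittK0.

Variables (k : fieldType) (E : graph).

(* beta is the order isomorphism K_0^gr(L_k(E)) -> G_A of Z[x,x^-1]-modules   *)
(* with [v L_k(E)] |-> [e_v, 0]; it is unique.                                *)
Definition is_beta (beta : K0gr (lpa_gr k E) -> dimG (adj E)) : Prop :=
  [/\ bijective beta,
      forall a b, beta (K0_add a b) = dimG_add (beta a) (beta b),
      forall a, beta (K0_shift a) = dimG_x (beta a),
      forall a, K0_pos a <-> dimG_pos (beta a)
    & forall v : vert E,
        beta (K0_class (vL_fgp k v)) = dimG_class (adj E) (delta_mx (enum_rank v) 0) 0].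

End LeavittK0.

(* x^j K_0^gr(xi) is v |-> v R, when K_0^gr(L_k(E)) is identified with the    *)
(* dimension group Delta of E by psi^-1 o beta, and likewise for F.           *)
Definition induces_dim_map (k : fieldType) (E F : graph)
    (xi : {rmorphism lpa_gr k E -> lpa_gr k F}) (j : nat)
    (R : 'M[nat]_(#|vert E|, #|vert F|)) : Prop :=
  exists f : K0gr (lpa_gr k E) -> K0gr (lpa_gr k F),
    is_K0_map xi f /\
    forall betaE betaF, is_beta betaE -> is_beta betaF ->
    forall (a : K0gr (lpa_gr k E)) (v : Delta (adj E)), psi v = betaE a ->
    exists w : Delta (adj F),
      dim_map R v w /\ psi w = betaF (iter j (@K0_shift _) (f a)).

Definition graded_iso (k : fieldType) (E F : graph)
    (phi : {rmorphism lpa_gr k E -> lpa_gr k F})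
    (phi' : {rmorphism lpa_gr k F -> lpa_gr k E}) : Prop :=
  [/\ cancel phi phi', cancel phi' phi, scalable phi
    & forall n x, lpa_deg n x <-> lpa_deg n (phi x)].

Section Bimodules.

Variable k : fieldType.

(* The space with basis X.                                                    *)
Local Notation "<< X >>" := {ffun edge X -> k^o} (at level 0).

Section Actions.

Variables (V W : finType) (X : edgeset V W).

Definition basis (x : X) : << X >> := [ffun y => (y == x)%:R].

(* The algebra k V of the vertex set is {ffun V -> k}, the vertices being the *)
(* indicator functions of points.                                             *)
Definition lact (a : {ffun V -> k}) (f : << X >>) : << X >> :=
  [ffun x => a (src x) * f x].
Definition ract (f : << X >>) (b : {ffun W -> k}) : << X >> :=
  [ffun x => f x * b (rng x)].

(* The linear map << X >> -> M sending the basis vector x to h x.             *)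
Definition lin_ext (M : lmodType k) (h : X -> M) (f : << X >>) : M :=
  \sum_x f x *: h x.

End Actions.

Definition bimod_iso (V W : finType) (X Y : edgeset V W)
    (h : {linear << X >> -> << Y >>}) : Prop :=
  [/\ bijective h, forall a f, h (lact a f) = lact a (h f)
    & forall f b, h (ract f b) = ract (h f) b].

(* The set of composable pairs; its span is the tensor product of << X >> and *)
(* << Y >> over k V, see tens_is_tensor below.                                *)
Definition ecomp (U V W : finType) (X : edgeset U V) (Y : edgeset V W) :
    edgeset U W :=
  @EdgeSet U W {p : X * Y | rng p.1 == src p.2}
    (fun p => src (val p).1) (fun p => rng (val p).2).

Definition tens (U V W : finType) (X : edgeset U V) (Y : edgeset V W)
    (f : << X >>) (g : << Y >>) : << ecomp X Y >> :=
  [ffun p => f (val p).1 * g (val p).2].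

Definition tmap (U V W : finType) (X X' : edgeset U V) (Y Y' : edgeset V W)
    (h : << X >> -> << X' >>) (h' : << Y >> -> << Y' >>) :
    << ecomp X Y >> -> << ecomp X' Y' >> :=
  lin_ext (fun p : ecomp X Y => tens (h (basis (val p).1)) (h' (basis (val p).2))).

Definition tassoc (S U V W : finType) (X : edgeset S U) (Y : edgeset U V)
    (Z : edgeset V W) : << ecomp (ecomp X Y) Z >> -> << ecomp X (ecomp Y Z) >> :=
  lin_ext (fun p : ecomp (ecomp X Y) Z =>
    let q := val (val p).1 in
    tens (basis q.1) (tens (basis q.2) (basis (val p).2))).

Definition tassocV (S U V W : finType) (X : edgeset S U) (Y : edgeset U V)
    (Z : edgeset V W) : << ecomp X (ecomp Y Z) >> -> << ecomp (ecomp X Y) Z >> :=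
  lin_ext (fun p : ecomp X (ecomp Y Z) =>
    let q := val (val p).2 in
    tens (tens (basis (val p).1) (basis q.1)) (basis q.2)).

(* The (n+1)-fold tensor power, bracketed to the right.                       *)
Fixpoint tpow (V : finType) (X : edgeset V V) (n : nat) : edgeset V V :=
  if n is n'.+1 then ecomp X (tpow X n') else X.

(* x (x) (x_0 (x) ... (x) x_n) |-> (x (x) x_0 (x) ... (x) x_(n-1)) (x) x_n    *)
Fixpoint nu (V : finType) (X : edgeset V V) (n : nat) :
    << ecomp X (tpow X n) >> -> << ecomp (tpow X n) X >> :=
  match n return << ecomp X (tpow X n) >> -> << ecomp (tpow X n) X >> with
  | 0 => idfun
  | n'.+1 => @tassocV _ _ _ _ X (tpow X n') X \o tmap idfun (@nu V X n')
  end.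

(* The lag is m = n.+1.                                                       *)
Definition aligned_mse (E F : graph)
    (G : edgeset (vert E) (vert F)) (H : edgeset (vert F) (vert E)) : Prop :=
  exists (n : nat)
    (omE : {linear << ecomp G H >> -> << tpow (edges E) n >>})
    (omF : {linear << ecomp H G >> -> << tpow (edges F) n >>})
    (sgG : {linear << ecomp (edges E) G >> -> << ecomp G (edges F) >>})
    (sgH : {linear << ecomp (edges F) H >> -> << ecomp H (edges E) >>}),
  [/\ [/\ bimod_iso omE, bimod_iso omF, bimod_iso sgG & bimod_iso sgH],
      tmap omE idfun \o @tassocV _ _ _ _ _ _ _ \o tmap idfun sgH
        \o @tassoc _ _ _ _ _ _ _ \o tmap sgG idfun
      =1 @nu _ (edges E) n \o tmap idfun omE \o @tassoc _ _ _ _ _ _ _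
    & tmap omF idfun \o @tassocV _ _ _ _ _ _ _ \o tmap idfun sgG
        \o @tassoc _ _ _ _ _ _ _ \o tmap sgH idfun
      =1 @nu _ (edges F) n \o tmap idfun omF \o @tassoc _ _ _ _ _ _ _].

Lemma tens_is_tensor (U V W : finType) (X : edgeset U V) (Y : edgeset V W) :
  is_tensor (@ract U V X) (@lact V W Y) (@tens U V W X Y).
Proof.
split.
  split=> [f f' g|f g g'|f a g]; apply/ffunP => p; rewrite !ffunE.
  - exact: mulrDl.
  - exact: mulrDr.
  - by rewrite (eqP (valP p)) mulrA.
move=> Q g [gDl gDr gB].
have g0l y : g 0 y = 0 by apply: (@addrI _ (g 0 y)); rewrite -gDl !addr0.
have g0r x : g x 0 = 0 by apply: (@addrI _ (g x 0)); rewrite -gDr !addr0.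
pose c (X' : finType) (x : X') (a : k^o) : {ffun X' -> k^o} :=
  [ffun y => if y == x then a else 0].
have cD (X' : finType) (x : X') a b : c X' x (a + b) = c X' x a + c X' x b.
  by apply/ffunP => y; rewrite !ffunE; case: eqP => // _; rewrite addr0.
have csum (X' : finType) (f : {ffun X' -> k^o}) : f = \sum_x c X' x (f x).
  apply/ffunP => y; rewrite sum_ffunE (bigD1 y) //= ffunE eqxx big1 ?addr0 //.
  by move=> x /negPf xy; rewrite ffunE eq_sym xy.
pose hf (f : << ecomp X Y >>) : Q :=
  \sum_p g (c X (val p).1 (f p)) (basis (val p).2).
have hfD : zmod_morphism hf.
  move=> f f'; rewrite /hf -sumrB; apply: eq_bigr => p _.
  rewrite !ffunE cD gDl; congr (_ + _).
  apply/eqP; rewrite -addr_eq0 -gDl -cD addNr.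
  suff -> : c X (val p).1 0 = 0 by rewrite g0l.
  by apply/ffunP => y; rewrite !ffunE if_same.
pose h : {additive << ecomp X Y >> -> Q} :=
  HB.pack hf (GRing.isZmodMorphism.Build _ _ _ hfD).
have gc (x : X) (y : Y) a b :
    g (c X x a) (c Y y b) = if rng x == src y then g (c X x (a * b)) (basis y) else 0.
  have cr w : ract (c X x a) [ffun w' => (w' == w)%:R] = if rng x == w then c X x a else 0.
    apply/ffunP => z; rewrite !ffunE; case: (eqVneq z x) => [->|zx].
      by case: eqP => _; rewrite ?ffunE ?eqxx ?mulr1 ?mulr0.
    by rewrite mul0r; case: ifP; rewrite !ffunE ?(negPf zx).
  have xE : c X x a = ract (c X x a) [ffun w => (w == rng x)%:R] by rewrite cr eqxx.
  case: eqVneq => [xy|xy].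
    have -> : c Y y b = lact [ffun=> b] (basis y).
      by apply/ffunP => z; rewrite !ffunE; case: eqP; rewrite ?mulr1 ?mulr0.
    rewrite -gB; congr (g _ _); apply/ffunP => z; rewrite !ffunE.
    by case: eqP => // _; rewrite mul0r.
  have -> : c Y y b = lact [ffun w => (w == src y)%:R] (c Y y b).
    apply/ffunP => z; rewrite !ffunE; case: (eqVneq z y) => [->|_]; last by rewrite mulr0.
    by rewrite eqxx mul1r.
  by rewrite -gB cr (negPf xy) g0l.
have gsum (I J : finType) (f : I -> << X >>) (f' : J -> << Y >>) :
    g (\sum_i f i) (\sum_j f' j) = \sum_i \sum_j g (f i) (f' j).
  rewrite (big_morph (g^~ _) (fun x x' => gDl x x' _) (g0l _)).
  by apply: eq_bigr => i _; rewrite (big_morph (g _) (gDr _) (g0r _)).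
have hE f f' : h (tens f f') = g f f'.
  rewrite [f in RHS]csum [f' in RHS]csum gsum pair_big /=.
  rewrite (eq_bigr (fun p : X * Y => if rng p.1 == src p.2 then
    g (c X p.1 (f p.1 * f' p.2)) (basis p.2) else 0)); last by move=> p _; rewrite gc.
  rewrite -big_mkcond (reindex_omap (val : ecomp X Y -> X * Y) insub) /=; last first.
    by move=> p pP; rewrite insubT.
  rewrite /h /= /hf; apply: eq_big => [[p pP]|p _]; last by rewrite ffunE.
  by rewrite /= pP insubT /= eqxx.
exists h; split=> // h' h'E f.
have -> : f = \sum_p tens (c X (val p).1 (f p)) (basis (val p).2).
  apply/ffunP => q; rewrite sum_ffunE (bigD1 q) //= !ffunE !eqxx mulr1 big1 ?addr0 //.
  move=> p pq; rewrite !ffunE; case: eqP => [q1|_]; last by rewrite mul0r.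
  case: eqP => [q2|_]; last by rewrite mulr0.
  by case/eqP: pq; apply: val_inj; rewrite [LHS]surjective_pairing -q1 -q2 -surjective_pairing.
by rewrite !raddf_sum; apply: eq_bigr => p _; rewrite h'E hE.
Qed.

End Bimodules.

Definition mx_edges (V W : finType) (R : 'M[nat]_(#|V|, #|W|)) : edgeset V W :=
  @EdgeSet V W {vw : V * W & 'I_(R (enum_rank vw.1) (enum_rank vw.2))}
    (fun x => (tag x).1) (fun x => (tag x).2).

Definition unitally_aligned_mse (k : fieldType) (E F : graph)
    (R : 'M[nat]_(#|vert E|, #|vert F|)) (S : 'M[nat]_(#|vert F|, #|vert E|)) :
    Prop :=
  (unital_dim_map (adj E) (adj F) R \/ unital_dim_map (adj F) (adj E) S) /\
  aligned_mse k (mx_edges R) (mx_edges S).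

(* Main.v *)
Require Import Defs.
From HB Require Import structures.
From mathcomp Require Import all_boot all_order all_algebra.
From mathcomp Require Import boolp zify.

(** Write L(E) for the Leavitt path algebra of E. In the language of modules
    the theorem is true for the following reason. The isomorphism sigma_G makes
    M = kG (x) L(F) a graded L(E)-L(F)-bimodule: an edge e of E acts by sigma_G
    followed by the multiplication of L(F), and the ghost edge e^* acts by the
    inverse of sigma_G, which is possible because without sinks kF^1 (x) L(F) is
    L(F). Likewise N = kH (x) L(E) is an L(F)-L(E)-bimodule. The alignment
    equations say exactly that omega_E and omega_F induce left linear maps from
    M (x) N and N (x) M to the regular bimodules, up to a shift. Hence L(E) is
    the endomorphism ring of M. If R is unital, then M is L(F) as a graded right
    module, and L(E) = End(M) = L(F).

    The proof replaces modules by elements. A frame over an edge set X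
    (definition [frame]) is a family of pairs (a_x, b_x) with b_x a_y = 0 for
    x <> y and b_x a_x = r(x), such that the sum of the a_x b_x is 1; a frame over
    G in L(F) is the same thing as an isomorphism M = L(F) of right modules.
    Frames compose, and they can be transported along bimodule isomorphisms and
    divided by other frames. They carry the proof as follows.
    - If R is unital, then 1 R B^l = 1 B^l for some l, that is, the pairs of an
      edge of G and a composable path of length l in F are in range preserving
      bijection with the paths of length l. This gives a frame over G
      ([frame_exists]). The matrix S preserves order units up to a power of x,
      which gives a frame over H of nonzero degree.
    - A frame over G and sigma_G yield a graded homomorphism phi from L(E) to
      L(F) ([edge_hom]); a frame over H and sigma_H yield psi from L(F) to L(E).
    - By alignment psi o phi is conjugation by a unit ([aligned_conj]), namely by
      the change of frame from the paths omega_E(g (x) h) to the products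
      psi(a_g) a_h. The same holds for phi o psi. So phi is bijective.
    - Since phi is invertible, the extension of scalars along phi is the
      restriction of scalars along its inverse, and the frame identifies the
      restriction of v L(E) with the sum of the r(g) L(F) for s(g) = v
      ([restr_vertex]). This is the map R on the generators [e_v, 0] of the
      dimension group, and therefore everywhere ([beta_restr]). As R S = A^m, the
      inverse of phi induces S up to x^m.

    When S is unital instead, exchange E and F. *)

Set Implicit Arguments.
Unset Strict Implicit.
Unset Printing Implicit Defensive.

Import Order.TTheory GRing.Theory Num.Theory.
Local Open Scope ring_scope.

Local Notation "k << X >>" := {ffun edge X -> k^o} (at level 2).

(** * Leavitt path algebras: relations and universal property *)

Section LeavittRelations.

Variables (k : fieldType) (E : graph).
Local Notation L := (lpa k E).
Local Notation vv := (@lpa_vert k E).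
Local Notation ee := (@lpa_edge k E).
Local Notation gg := (@lpa_ghost k E).

Lemma lpa_edge_rng e : ee e * vv (rng e) = ee e.
Proof. by rewrite -lpa_Lmul; apply/lpaP/Ler. Qed.

Lemma lpa_rng_ghost e : vv (rng e) * gg e = gg e.
Proof. by rewrite -lpa_Lmul; apply/lpaP/Lrg. Qed.

Lemma lpa_ghost_edge e f : gg e * ee f = if e == f then vv (rng e) else 0.
Proof.
rewrite -lpa_Lmul; case: eqVneq => [<-|ef]; apply/lpaP; first exact: Lge.
exact: Lgf.
Qed.

Lemma lpa_CK2 (hE : no_sinks E) v :
  \sum_(e : edges E | src e == v) ee e * gg e = vv v.
Proof.
rewrite [RHS](_ : _ = cls (@leq_term k E) (LVert k v)) //.
have /lpaP -> := @Lck k E v (hE v).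
rewrite lpa_sumE big_map big_filter big_enum_cond /=.
by apply: eq_bigr => e _; rewrite -lpa_Lmul.
Qed.

Lemma lpa_sum_vert : \sum_v vv v = 1.
Proof. by rewrite [RHS]lpa_sumE big_map big_enum. Qed.

Lemma lpa_gen_ind (P : L -> Prop) :
  (forall v, P (vv v)) -> (forall e, P (ee e)) -> (forall e, P (gg e)) ->
  P 0 -> (forall x y, P x -> P y -> P (x + y)) ->
  (forall c x, P x -> P (c *: x)) ->
  (forall x y, P x -> P y -> P (x * y)) -> forall x, P x.
Proof.
move=> Pv Pe Pg P0 PD PZ PM x; rewrite -(repK x).
elim: (rep x) => {x} [v|e|e||a IHa b IHb|a IHa|c a IHa|a IHa b IHb].
- exact: Pv.
- exact: Pe.
- exact: Pg.
- exact: P0.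
- by rewrite lpa_Ladd; apply: PD.
- by rewrite lpa_Lopp -scaleN1r; apply: PZ.
- by rewrite lpa_Lscale; apply: PZ.
- by rewrite lpa_Lmul; apply: PM.
Qed.

End LeavittRelations.

Section Universal.

Variables (k : fieldType) (E F : graph).
Local Notation L := (lpa k F).
Variables (pv : vert E -> L) (pe pg : edges E -> L).

Definition leavitt_family : Prop :=
  [/\ \sum_v pv v = 1,
      forall v w, pv v * pv w = if v == w then pv v else 0,
      (forall e, pv (src e) * pe e = pe e /\ pe e * pv (rng e) = pe e) /\
      (forall e, pv (rng e) * pg e = pg e /\ pg e * pv (src e) = pg e),
      forall e f, pg e * pe f = if e == f then pv (rng e) else 0
    & forall v, (exists e : edges E, src e = v) ->
        \sum_(e : edges E | src e == v) pe e * pg e = pv v].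

Fixpoint term_eval (t : lterm k E) : L :=
  match t with
  | LVert v => pv v
  | LEdge e => pe e
  | LGhost e => pg e
  | LZero => 0
  | LAdd a b => term_eval a + term_eval b
  | LOpp a => - term_eval a
  | LScale c a => c *: term_eval a
  | LMul a b => term_eval a * term_eval b
  end.

Lemma term_eval_sum (s : seq (lterm k E)) :
  term_eval (LSum s) = \sum_(a <- s) term_eval a.
Proof. by elim: s => [|a s IHs] /=; rewrite ?big_nil ?big_cons ?IHs. Qed.

Lemma term_eval_rel (fam : leavitt_family) a b :
  leq_term a b -> term_eval a = term_eval b.
Proof.
case: fam => pv1 pvv [pse psg] pge pck; elim=> //= {a b}.
- by move=> a b c _ -> _ ->.
- by move=> a a' b b' _ -> _ ->.
- by move=> a a' _ ->.
- by move=> c a a' _ ->.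
- by move=> a a' b b' _ -> _ ->.
- by move=> a b c; rewrite addrA.
- by move=> a b; rewrite addrC.
- by move=> a; rewrite add0r.
- by move=> a; rewrite addNr.
- by move=> c d a; rewrite scalerA.
- by move=> a; rewrite scale1r.
- by move=> c a b; rewrite scalerDr.
- by move=> c d a; rewrite scalerDl.
- by move=> a b c; rewrite mulrA.
- by move=> a b c; rewrite mulrDl.
- by move=> a b c; rewrite mulrDr.
- by move=> c a b; rewrite lpa_scalerAl.
- by move=> c a b; rewrite lpa_scalerAr.
- by move=> v; rewrite pvv eqxx.
- by move=> v w /negPf vw; rewrite pvv vw.
- by move=> e; case: (pse e).
- by move=> e; case: (pse e).
- by move=> e; case: (psg e).
- by move=> e; case: (psg e).
- by move=> e; rewrite pge eqxx.
- by move=> e f /negPf ef; rewrite pge ef.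
- move=> v ve; rewrite term_eval_sum big_map big_filter big_enum_cond /=.
  by rewrite pck.
Qed.

Definition lpa_lift (x : lpa k E) : L := term_eval (rep x).

Lemma lpa_liftE (fam : leavitt_family) t :
  lpa_lift (cls (@leq_term k E) t) = term_eval t.
Proof. by apply: term_eval_rel; last exact: rep_cls (@leq_term_equiv k E). Qed.

(** Elements of L(E) are classes of terms, so a homomorphism is obtained by
    evaluating terms, and the defining congruence is respected by construction
    of a Leavitt family. *)
Lemma lpa_universal (fam : leavitt_family) :
  exists phi : {rmorphism lpa k E -> L},
    [/\ scalable phi, forall v, phi (lpa_vert k v) = pv v,
        forall e, phi (lpa_edge k e) = pe e
      & forall e, phi (lpa_ghost k e) = pg e].
Proof.
have lE := lpa_liftE fam.
have lD : zmod_morphism lpa_lift.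
  move=> x y; rewrite -(repK x) -(repK y) -lpa_Lopp -lpa_Ladd !lE /=.
  by rewrite -!lE.
have lM : monoid_morphism lpa_lift.
  split=> [|x y].
    rewrite -lpa_sum_vert (big_morph lpa_lift (id1 := 0) (op1 := +%R)) => [|x y|].
    - case: fam => <- *; apply: eq_bigr => v _.
      exact: (lE (LVert k v)).
    - by rewrite -(repK x) -(repK y) -lpa_Ladd !lE /= -!lE.
    - exact: (lE (LZero k E)).
  by rewrite -(repK x) -(repK y) -lpa_Lmul !lE /= -!lE.
pose phi : {rmorphism lpa k E -> L} := HB.pack lpa_lift
  (GRing.isZmodMorphism.Build _ _ _ lD) (GRing.isMonoidMorphism.Build _ _ _ lM).
exists phi; split=> [c x|v|e|e] /=; last 3 first.
- exact: (lE (LVert k v)).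
- exact: (lE (LEdge k e)).
- exact: (lE (LGhost k e)).
by rewrite -(repK x) -lpa_Lscale !lE.
Qed.

End Universal.

(** * Linear maps on tensor products of edge spaces *)

(** The shape in which all sums over composable pairs are computed: only the
    first edge is constrained by the outer condition. *)
Lemma big_ecomp (R : Type) (idx : R) (op : Monoid.com_law idx)
    (U V W : finType) (X : edgeset U V) (Y : edgeset V W)
    (C : pred X) (G : X -> Y -> R) :
  \big[op/idx]_(p : ecomp X Y | C (val p).1) G (val p).1 (val p).2 =
  \big[op/idx]_(x | C x) \big[op/idx]_(y | src y == rng x) G x y.
Proof.
rewrite pair_big_dep /= (reindex_omap (val : ecomp X Y -> X * Y) insub) /=.
  apply: eq_bigl => -[[x y] xy] /=.
  by rewrite insubT /= eqxx andbT eq_sym xy andbT.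
by move=> [x y] /andP[_ xy]; rewrite insubT // eq_sym.
Qed.

Lemma ecomp_eqP (U V W : finType) (X : edgeset U V) (Y : edgeset V W)
    (p q : ecomp X Y) :
  (val p).1 = (val q).1 -> (val p).2 = (val q).2 -> p = q.
Proof.
move=> pq1 pq2; apply: val_inj.
by rewrite [LHS]surjective_pairing pq1 pq2 -surjective_pairing.
Qed.

Section LinearExtension.

Variable k : fieldType.

Section Basic.

Variables (V W : finType) (X : edgeset V W) (M : lmodType k).

Lemma lin_ext_basis (h : X -> M) x : lin_ext h (basis k x) = h x.
Proof.
rewrite /lin_ext (bigD1 x) //= ffunE eqxx scale1r big1 ?addr0 // => y /negPf yx.
by rewrite ffunE yx scale0r.
Qed.

Lemma lin_extZD (h : X -> M) c (f g : k<<X>>) :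
  lin_ext h (c *: f + g) = c *: lin_ext h f + lin_ext h g.
Proof.
rewrite /lin_ext scaler_sumr -big_split; apply: eq_bigr => x _.
by rewrite !ffunE scalerDl scalerA.
Qed.

Lemma lin_ext_sumZ (h : X -> M) (I : finType) (c : I -> k) (f : I -> k<<X>>) :
  lin_ext h (\sum_i c i *: f i) = \sum_i c i *: lin_ext h (f i).
Proof.
elim/big_rec2: _ => [|i x y _ <-]; last by rewrite lin_extZD.
by rewrite /lin_ext big1 // => x _; rewrite ffunE scale0r.
Qed.

Lemma eq_lin_ext (h h' : X -> M) : h =1 h' -> lin_ext (k := k) h =1 lin_ext h'.
Proof. by move=> hh' f; apply: eq_bigr => x _; rewrite hh'. Qed.

Lemma sum_basis (f : k<<X>>) : f = \sum_x f x *: basis k x.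
Proof.
apply/ffunP => y; rewrite sum_ffunE (bigD1 y) //= !ffunE eqxx.
rewrite [_ *: _]mulr1 big1 ?addr0 // => x /negPf xy.
by rewrite !ffunE eq_sym xy; apply: mulr0.
Qed.

End Basic.

Section Tensors.

Variables (U V W : finType) (X : edgeset U V) (Y : edgeset V W).

Lemma tens_basis x y (xy : rng x == src y) :
  tens (basis k x) (basis k y) = basis k (Sub (x, y) xy : ecomp X Y).
Proof.
by apply/ffunP => q; rewrite !ffunE -natrM mulnb.
Qed.

Lemma tens_basis_val (p : ecomp X Y) :
  tens (basis k (val p).1) (basis k (val p).2) = basis k p.
Proof.
by rewrite (tens_basis (valP p)); congr (basis k _); apply: ecomp_eqP.
Qed.

End Tensors.

Section Products.

Variable F : graph.
Local Notation L := (lpa k F).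

Definition pair_mul (U V W : finType) (X : edgeset U V) (Y : edgeset V W)
  (c : X -> L) (d : Y -> L) (p : ecomp X Y) : L := c (val p).1 * d (val p).2.

(** Multiplication of L, composed with c and d, is defined on all pairs of
    edges, whereas the tensor product sees only the composable ones. This is the
    condition under which nothing is lost. *)
Definition matched (U V W : finType) (X : edgeset U V) (Y : edgeset V W)
    (c : X -> L) (d : Y -> L) : Prop :=
  forall x y, rng x != src y -> c x * d y = 0.

Section Pairs.

Variables (U V W : finType) (X : edgeset U V) (Y : edgeset V W).

Lemma lpa_mul_sumZ (I J : finType) (a : I -> k) (b : J -> k) (x : I -> L) (y : J -> L) :
  (\sum_i a i *: x i) * (\sum_j b j *: y j) =
  \sum_i \sum_j (a i * b j) *: (x i * y j).
Proof.
rewrite mulr_suml; apply: eq_bigr => i _; rewrite mulr_sumr.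
by apply: eq_bigr => j _; rewrite -lpa_scalerAl -lpa_scalerAr scalerA.
Qed.

(** Together with the next lemmas this is how identities between bimodule
    maps are read in L: multiply out both sides by [pair_mul]. *)
Lemma lin_ext_tens (c : X -> L) (d : Y -> L) f g : matched c d ->
  lin_ext (pair_mul c d) (tens f g) = lin_ext c f * lin_ext d g.
Proof.
move=> cd; rewrite /lin_ext lpa_mul_sumZ.
under eq_bigr do rewrite ffunE.
rewrite (big_ecomp +%R xpredT (fun x y => (f x * g y : k) *: (c x * d y))).
apply: eq_bigr => x _; rewrite big_mkcond; apply: eq_bigr => y _.
by case: eqVneq => // yx; rewrite cd ?scaler0 // eq_sym.
Qed.

End Pairs.

Section PairMaps.

Variables (U V W : finType) (X : edgeset U V) (Y : edgeset V W).

Lemma lin_ext_tmap (X' : edgeset U V) (Y' : edgeset V W) (c : X' -> L) (d : Y' -> L)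
    (h : k<<X>> -> k<<X'>>) (h' : k<<Y>> -> k<<Y'>>) f : matched c d ->
  lin_ext (pair_mul c d) (tmap h h' f) =
  lin_ext (pair_mul (fun x => lin_ext c (h (basis k x)))
                    (fun y => lin_ext d (h' (basis k y)))) f.
Proof.
move=> cd; rewrite /tmap {2}/lin_ext lin_ext_sumZ.
by apply: eq_bigr => p _; rewrite lin_ext_tens.
Qed.

Variables (W' : finType) (Z : edgeset W W').

(** The associator sends basis vectors to basis vectors, so after multiplication
    in L it is mere associativity. *)
Lemma lin_ext_tassoc (c : X -> L) (d : Y -> L) (e : Z -> L) f :
  lin_ext (pair_mul c (pair_mul d e)) (tassoc f) =
  lin_ext (pair_mul (pair_mul c d) e) f.
Proof.
rewrite /tassoc {2}/lin_ext lin_ext_sumZ; apply: eq_bigr.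
move=> [[[[x y] /= xy] z] /= yz] _ /=; rewrite !tens_basis /=.
by rewrite lin_ext_basis /pair_mul /= mulrA.
Qed.

Lemma lin_ext_tassocV (c : X -> L) (d : Y -> L) (e : Z -> L) f :
  lin_ext (pair_mul (pair_mul c d) e) (tassocV f) =
  lin_ext (pair_mul c (pair_mul d e)) f.
Proof.
rewrite /tassocV {2}/lin_ext lin_ext_sumZ; apply: eq_bigr.
move=> [[x [[y z] /= yz]] /= xy] _ /=; rewrite !tens_basis /=.
by rewrite lin_ext_basis /pair_mul /= mulrA.
Qed.

End PairMaps.

End Products.

End LinearExtension.

(** * Frames *)

Section BimoduleIsomorphisms.

Variables (k : fieldType) (V W : finType).

Lemma bimod_iso_inv (X Y : edgeset V W) (h : {linear k<<X>> -> k<<Y>>}) :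
  bimod_iso h -> exists g : {linear k<<Y>> -> k<<X>>},
    [/\ bimod_iso g, cancel h g & cancel g h].
Proof.
case=> [[g hK gK] hl hr].
have gL : linear g by move=> c x y; apply: (can_inj hK); rewrite linearP !gK.
pose g' : {linear k<<Y>> -> k<<X>>} := HB.pack g (GRing.isLinear.Build _ _ _ _ _ gL).
exists g'; split=> //; split=> [|a f|f b]; first by exists h.
  by apply: (can_inj hK); rewrite hl !gK.
by apply: (can_inj hK); rewrite hr !gK.
Qed.

(** Apply the linearity of h over the vertex algebras to the indicator functions
    of the source and of the range of x: the matrix of h is block diagonal. *)
Lemma bimod_iso_basis (X Y : edgeset V W) (h : {linear k<<X>> -> k<<Y>>}) x y :
  bimod_iso h -> h (basis k x) y != 0 -> src y = src x /\ rng y = rng x.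
Proof.
case=> _ hl hr nz.
have /(congr1 (fun f : k<<Y>> => f y)) := hl [ffun v => (v == src x)%:R] (basis k x).
have -> : lact [ffun v => (v == src x)%:R] (basis k x) = basis k x.
  apply/ffunP => z; rewrite !ffunE; case: (eqVneq z x) => [->|_]; last exact: mulr0.
  by rewrite eqxx mulr1.
have /(congr1 (fun f : k<<Y>> => f y)) := hr (basis k x) [ffun v => (v == rng x)%:R].
have -> : ract (basis k x) [ffun v => (v == rng x)%:R] = basis k x.
  apply/ffunP => z; rewrite !ffunE; case: (eqVneq z x) => [->|_]; last exact: mul0r.
  by rewrite eqxx mul1r.
rewrite !ffunE => er es; split; apply/eqP; apply: contraNT nz => /negPf ne.
  by rewrite es ne mul0r.
by rewrite er ne mulr0.
Qed.

Lemma linear_basis_comp (X Y Z : edgeset V W) (h : {linear k<<X>> -> k<<Y>>})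
    (g : {linear k<<Y>> -> k<<Z>>}) x z :
  g (h (basis k x)) z = \sum_y h (basis k x) y * g (basis k y) z.
Proof.
rewrite {1}(sum_basis (h _)) linear_sum sum_ffunE; apply: eq_bigr => y _.
by rewrite linearZ ffunE.
Qed.

End BimoduleIsomorphisms.

Section Frames.

Variables (k : fieldType) (F : graph).
Local Notation L := (lpa k F).
Local Notation vv := (@lpa_vert k F).

Section Basics.

Variables (V W : finType) (X : edgeset V W).

(** An element-wise description of an isomorphism of graded right modules
    between the direct sum of the Q (r(x)) L, over the edges x, and L, shifted by
    d: it sends the generator of index x to a_x, and its inverse sends y to the
    family of the b_x y. The idempotents P v remember the left action of the
    source vertices. For a graph without sinks, graded Leavitt families are the
    frames over its edge set with P = Q and d = 1. *)
Definition frame (d : int) (a b : X -> L) (P : V -> L)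
    (Q : W -> L) : Prop :=
  [/\ forall x y, b x * a y = if x == y then Q (rng x) else 0,
      forall v, \sum_(x : X | src x == v) a x * b x = P v,
      \sum_v P v = 1
    & forall x, lpa_deg d (a x) /\ lpa_deg (- d) (b x)].

Variables (d : int) (a b : X -> L) (P : V -> L) (Q : W -> L).
Hypothesis fr : frame d a b P Q.

Lemma frame_sum : \sum_x a x * b x = 1.
Proof.
case: fr => _ sP <- _; rewrite (partition_big (@src _ _ X) xpredT) //=.
by apply: eq_bigr => v _; rewrite -sP.
Qed.

(** Insert the unit as the sum of the a_y b_y; only the term y = x survives. *)
Lemma frame_rngl x : a x * Q (rng x) = a x.
Proof.
rewrite -[RHS]mul1r -frame_sum mulr_suml (bigD1 x) //= big1 => [|y /negPf yx].
  by case: fr => ba _ _ _; rewrite addr0 -mulrA ba eqxx.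
by case: fr => ba _ _ _; rewrite -mulrA ba yx mulr0.
Qed.

Lemma frame_rngr x : Q (rng x) * b x = b x.
Proof.
rewrite -[RHS]mulr1 -frame_sum mulr_sumr (bigD1 x) //= big1 => [|y /negPf yx].
  by case: fr => ba _ _ _; rewrite addr0 mulrA ba eqxx.
by case: fr => ba _ _ _; rewrite mulrA ba eq_sym yx mul0r.
Qed.

Lemma frame_srcl v x : P v * a x = if src x == v then a x else 0.
Proof.
case: fr => ba sP _ _; rewrite -sP mulr_suml; case: eqVneq => [xv|xv].
  rewrite (bigD1 x) ?xv //= -mulrA ba eqxx frame_rngl big1 ?addr0 //.
  by move=> y /andP[_ /negPf yx]; rewrite -mulrA ba yx mulr0.
rewrite big1 // => y /eqP yv; rewrite -mulrA ba; case: eqVneq => [yx|]; last by rewrite mulr0.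
by rewrite -yv yx eqxx in xv.
Qed.

Lemma frame_srcr v x : b x * P v = if src x == v then b x else 0.
Proof.
case: fr => ba sP _ _; rewrite -sP mulr_sumr; case: eqVneq => [xv|xv].
  rewrite (bigD1 x) ?xv //= mulrA ba eqxx frame_rngr big1 ?addr0 //.
  by move=> y /andP[_ /negPf yx]; rewrite mulrA ba eq_sym yx mul0r.
rewrite big1 // => y /eqP yv; rewrite mulrA ba eq_sym; case: eqVneq => [yx|]; last by rewrite mul0r.
by rewrite -yv yx eqxx in xv.
Qed.

Lemma frame_proj v w : P v * P w = if v == w then P v else 0.
Proof.
case: (fr) => _ sP _ _; rewrite -[P w]sP mulr_sumr.
rewrite (eq_bigr (fun x => if v == w then a x * b x else 0)); last first.
  move=> x /eqP xw; rewrite mulrA frame_srcl xw eq_sym.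
  by case: ifP => //; rewrite mul0r.
by case: eqVneq => [->|_]; [exact: sP | rewrite big1].
Qed.

Lemma frame_deg_proj v : lpa_deg 0 (P v).
Proof.
case: fr => _ sP _ ab; rewrite -sP; elim/big_rec: _ => [|x y _ y0]; first exact: Dzero.
apply: Dadd => //; rewrite -(subrr d); case: (ab x); exact: Dmul.
Qed.

End Basics.

Lemma lpa_deg_sum n (I : finType) (C : pred I) (x : I -> L) :
  (forall i, C i -> lpa_deg n (x i)) -> lpa_deg n (\sum_(i | C i) x i).
Proof. by move=> xn; elim/big_ind: _ => //; [exact: Dzero | exact: Dadd]. Qed.

(** The relations e^* f = 0 or r(e) and v = sum of the e e^*; the latter holds
    at all vertices because there are no sinks. *)
Lemma frame_edges (hF : no_sinks F) :
  @frame _ _ (edges F) 1 (@lpa_edge k F) (@lpa_ghost k F) vv vv.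
Proof.
split; [exact: lpa_ghost_edge|exact: lpa_CK2|exact: lpa_sum_vert|].
by move=> e; split; [exact: Dedge | exact: Dghost].
Qed.

(** The matrix of h respects sources and ranges, so that a change of basis by it
    on the a_x, and by the inverse matrix on the b_x, alters neither the
    idempotents P nor Q. *)
Lemma frame_transport (V W : finType) (X X' : edgeset V W)
    (h : {linear k<<X'>> -> k<<X>>}) d a b P Q :
  bimod_iso h -> frame d a b P Q ->
  exists b', @frame V W X' d (fun x' => lin_ext a (h (basis k x'))) b' P Q.
Proof.
move=> hi fr; have [g [gi hK gK]] := bimod_iso_inv hi.
exists (fun x' => \sum_x (g (basis k x) x' : k) *: b x).
have gh x' y' : \sum_x h (basis k y') x * g (basis k x) x' = (x' == y')%:R.
  by rewrite -linear_basis_comp hK ffunE.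
have hg x y : \sum_x' g (basis k y) x' * h (basis k x') x = (x == y)%:R.
  by rewrite -linear_basis_comp gK ffunE.
case: (fr) => ba sP P1 ab; split=> // [x' y'|v|x'].
- rewrite lpa_mul_sumZ.
  transitivity (\sum_x (h (basis k y') x * g (basis k x) x' : k) *: Q (rng y')).
    apply: eq_bigr => x _; rewrite (bigD1 x) //= big1 => [|y /negPf yx]; last first.
      by rewrite ba (eq_sym x) yx scaler0.
    rewrite addr0 ba eqxx mulrC; case: (eqVneq (h (basis k y') x) 0) => [->|nz].
      by rewrite mul0r !scale0r.
    by have [_ ->] := bimod_iso_basis hi nz.
  rewrite -scaler_suml gh; case: eqVneq => [->|_]; first by rewrite scale1r.
  by rewrite scale0r.
- under eq_bigr => x' xv do rewrite lpa_mul_sumZ.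
  rewrite exchange_big -sP [RHS]big_mkcond; apply: eq_bigr => x _ /=.
  rewrite exchange_big /=.
  transitivity (\sum_y (if src y == v then (x == y)%:R : k else 0) *: (a x * b y)).
    apply: eq_bigr => y _; rewrite -scaler_suml; congr (_ *: _).
    rewrite big_mkcond /= -hg; case: (eqVneq (src y) v) => yv.
      apply: eq_bigr => x' _; rewrite mulrC.
      case: (eqVneq (g (basis k y) x') 0) => [->|nz]; first by rewrite mul0r if_same.
      by have [-> _] := bimod_iso_basis gi nz; rewrite yv eqxx.
    rewrite big1 // => x' _; case: (eqVneq (g (basis k y) x') 0) => [->|nz].
      by rewrite mulr0 if_same.
    by have [-> _] := bimod_iso_basis gi nz; rewrite (negPf yv).
  rewrite (bigD1 x) //= eqxx big1 ?addr0 => [|y /negPf yx]; last first.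
    by rewrite (eq_sym x) yx if_same scale0r.
  by case: ifP; rewrite ?scale1r ?scale0r.
- by split; apply: lpa_deg_sum => x _; apply: Dscale; case: (ab x).
Qed.

(** The identity a_x Q(r(x)) b_x = a_x b_x allows one to refine each term of the
    first frame by the part of the second frame starting at r(x). *)
Lemma frame_comp (U V W : finType) (X : edgeset U V) (Y : edgeset V W)
    m n a b c d P Q S :
  @frame U V X m a b P Q -> @frame V W Y n c d Q S ->
  frame (X := ecomp X Y) (m + n) (pair_mul a c)
    (fun p => d (val p).2 * b (val p).1) P S.
Proof.
move=> fa fc; case: (fa) => ba sP P1 ab; case: (fc) => dc sQ Q1 cd.
split=> // [p q|v|p].
- rewrite mulrA -[_ * b _ * _]mulrA ba; case: eqVneq => [pq1|pq1]; last first.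
    rewrite mulr0 mul0r; case: eqVneq => // pq.
    by rewrite pq eqxx in pq1.
  rewrite -mulrA (frame_srcl fc) pq1 (eqP (valP q)) eqxx dc.
  case: (eqVneq p q) => [->|pq]; first by rewrite eqxx.
  by case: eqVneq => // pq2; case/eqP: pq; apply: ecomp_eqP.
- rewrite /= (big_ecomp _ (fun x => src x == v)
    (fun x y => a x * c y * (d y * b x))) -sP.
  apply: eq_bigr => x _; transitivity (a x * Q (rng x) * b x).
    rewrite -sQ mulr_sumr mulr_suml.
    by apply: eq_bigr => y _; rewrite !mulrA.
  by rewrite (frame_rngl fa).
- case: (ab (val p).1) => a1 b1; case: (cd (val p).2) => c1 d1.
  by rewrite opprD [- m - n]addrC; split; apply: Dmul.
Qed.

Section Quotient.

Variables (U V W : finType) (X : edgeset U V) (Y : edgeset V W).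
Variables (m n : int) (c c' : ecomp X Y -> L) (y y' : Y -> L).
Variables (P : U -> L) (Q : V -> L) (S : W -> L).
Hypotheses (fc : frame m c c' P S) (fy : frame n y y' Q S).

Let a x := \sum_(p : ecomp X Y | (val p).1 == x) c p * y' (val p).2.
Let b x := \sum_(p : ecomp X Y | (val p).1 == x) y (val p).2 * c' p.

(** The quotient frame is the right inverse of [frame_comp] on the a side. *)
Lemma frame_quotK p : a (val p).1 * y (val p).2 = c p.
Proof.
case: (fy) => yy _ _ _; rewrite mulr_suml (bigD1 p) //= -mulrA yy eqxx (frame_rngl fc).
rewrite big1 ?addr0 // => q /andP[/eqP q1 qp]; rewrite -mulrA yy.
by case: eqVneq => [q2|_]; [case/eqP: qp; apply: ecomp_eqP | rewrite mulr0].
Qed.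

(** Dividing a frame on composable pairs by a frame on the second factors. It is
    used to extract the images of edges from a frame over E^1 (x) G, and to build
    frames from bijections between sets of paths. *)
Lemma frame_quot : frame (m - n) a b P Q.
Proof.
case: (fc) => cc sP P1 cd; case: (fy) => yy sQ _ yd; split=> // [x x'|v|x].
- rewrite /b mulr_suml; case: eqVneq => [<-|xx'].
    transitivity (\sum_(p : ecomp X Y | (val p).1 == x) y (val p).2 * y' (val p).2).
      apply: eq_bigr => p /eqP p1; rewrite /a mulr_sumr (bigD1 p) ?p1 //=.
      rewrite mulrA -[_ * c' p * _]mulrA cc eqxx (frame_rngl fy) big1 ?addr0 //.
      move=> q /andP[_ /negPf qp]; rewrite mulrA -[_ * c' p * _]mulrA cc.
      by rewrite eq_sym qp mulr0 mul0r.
    by rewrite (big_ecomp _ (pred1 x) (fun _ g => y g * y' g)) /= big_pred1_eq sQ.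
  rewrite big1 // => p /eqP p1; rewrite /a mulr_sumr big1 // => q /eqP q1.
  rewrite mulrA -[_ * c' p * _]mulrA cc; case: eqVneq => [pq|_].
    by rewrite -p1 -q1 pq eqxx in xx'.
  by rewrite mulr0 mul0r.
- rewrite -sP [RHS](partition_big (fun p => (val p).1) (fun x => src x == v)) //=.
  apply: eq_bigr => x /eqP xv; rewrite mulr_suml.
  rewrite [RHS](eq_bigl (fun p => (val p).1 == x)); last first.
    by move=> p /=; case: (_ =P x) => [->|_]; rewrite ?andbF // xv eqxx.
  apply: eq_bigr => p /eqP p1; rewrite /b mulr_sumr (bigD1 p) ?p1 //=.
  rewrite mulrA -[_ * y' _ * _]mulrA yy eqxx (frame_rngl fc) big1 ?addr0 //.
  move=> q /andP[/eqP q1 qp]; rewrite mulrA -[_ * y' _ * _]mulrA yy.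
  case: eqVneq => [q2|_]; last by rewrite mulr0 mul0r.
  by case/eqP: qp; apply: ecomp_eqP; rewrite ?q1 ?p1.
- rewrite opprB [n - m]addrC; split; apply: lpa_deg_sum => p _.
    by apply: Dmul; [case: (cd p) | case: (yd (val p).2)].
  by rewrite addrC; apply: Dmul; [case: (yd (val p).2) | case: (cd p)].
Qed.

End Quotient.

End Frames.

Lemma frame_map (k : fieldType) (E F : graph) (V W : finType) (X : edgeset V W)
    (psi : {rmorphism lpa k F -> lpa k E}) d a b P Q :
  (forall n x, lpa_deg n x -> lpa_deg n (psi x)) ->
  @frame k F V W X d a b P Q ->
  @frame k E V W X d (psi \o a) (psi \o b) (psi \o P) (psi \o Q).
Proof.
move=> pdeg [ba sP P1 ab]; split=> [x y|v||x] /=.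
- by rewrite -rmorphM ba; case: ifP; rewrite ?rmorph0.
- by rewrite -sP rmorph_sum; apply: eq_bigr => x _; rewrite rmorphM.
- by rewrite -rmorph_sum P1 rmorph1.
- by case: (ab x); split; apply: pdeg.
Qed.

(** * Homomorphisms given by frames *)

(** The axioms of a frame over E^1 with equal source and range idempotents imply
    the Leavitt relations. *)
Lemma frame_hom (k : fieldType) (E F : graph) a b P :
  @frame k F _ _ (edges E) 1 a b P P ->
  exists phi : {rmorphism lpa k E -> lpa k F},
    [/\ scalable phi, forall n x, lpa_deg n x -> lpa_deg n (phi x),
        forall v, phi (lpa_vert k v) = P v & forall e, phi (lpa_edge k e) = a e].
Proof.
move=> fa; case: (fa) => ba sP P1 ab.
have fam : leavitt_family P a b.
  split=> //; first exact: frame_proj fa.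
  split=> e.
    by rewrite (frame_srcl fa) eqxx (frame_rngl fa).
  by rewrite (frame_rngr fa) (frame_srcr fa) eqxx.
have [phi [phiZ phiv phie phig]] := lpa_universal fam.
exists phi; split=> // n x.
elim=> {n x} [v|e|e|n|n x y _ IHx _ IHy|n s x _ IHx|m n x y _ IHx _ IHy].
- by rewrite phiv; apply: frame_deg_proj fa _.
- by rewrite phie; case: (ab e).
- by rewrite phig; case: (ab e).
- by rewrite rmorph0; apply: Dzero.
- by rewrite rmorphD; apply: Dadd.
- by rewrite phiZ; apply: Dscale.
- by rewrite rmorphM; apply: Dmul.
Qed.

(** By composition, the frame over G extends to a frame over G (x) F^1;
    transport along sigma_G makes it a frame over E^1 (x) G, and division by the
    frame over G leaves a frame over E^1 whose range and source idempotents are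
    both P, that is, a homomorphism. The last property says that phi(e) acts on
    the frame as e acts on G through sigma_G. *)
Lemma edge_hom (k : fieldType) (E F : graph) (hF : no_sinks F)
    (G : edgeset (vert E) (vert F)) d a b P
    (sg : {linear k<<ecomp (edges E) G>> -> k<<ecomp G (edges F)>>}) :
  bimod_iso sg -> @frame k F _ _ G d a b P (@lpa_vert k F) ->
  exists phi : {rmorphism lpa k E -> lpa k F},
    [/\ scalable phi, forall n x, lpa_deg n x -> lpa_deg n (phi x),
        frame d a b (fun v => phi (lpa_vert k v)) (@lpa_vert k F)
      & forall p : ecomp (edges E) G,
          phi (lpa_edge k (val p).1) * a (val p).2 =
          lin_ext (pair_mul a (@lpa_edge k F)) (sg (basis k p))].
Proof.
move=> sgi fa; have fG := frame_comp fa (frame_edges k hF).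
have [c' fE] := frame_transport sgi fG.
have := frame_quot fE fa; rewrite addrAC subrr add0r => fe.
have [phi [phiZ phideg phiv phie]] := frame_hom fe.
exists phi; split=> // [|p]; last by rewrite phie (frame_quotK fE fa).
by rewrite (_ : (fun v => _) = P) //; apply: funext.
Qed.

(** * Paths, alignment and conjugation *)

Section Paths.

Variables (k : fieldType) (E : graph).
Local Notation L := (lpa k E).

Fixpoint lpa_path (n : nat) : tpow (edges E) n -> L :=
  match n return tpow (edges E) n -> L with
  | 0 => @lpa_edge k E
  | n'.+1 => pair_mul (@lpa_edge k E) (@lpa_path n')
  end.

(** The usual source of matching: c x ends and d y begins with idempotents of an
    orthogonal family. *)
Lemma matched_idem (U V W : finType) (X : edgeset U V) (Y : edgeset V W)
    (u : V -> L) (c : X -> L) (d : Y -> L) :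
  (forall x, c x * u (rng x) = c x) ->
  (forall v y, u v * d y = if src y == v then d y else 0) -> matched c d.
Proof.
by move=> cu ud x y xy; rewrite -cu -mulrA ud eq_sym (negPf xy) mulr0.
Qed.

Hypothesis hE : no_sinks E.

Lemma frame_path n : exists b, frame n.+1%:Z (@lpa_path n) b (@lpa_vert k E) (@lpa_vert k E).
Proof.
elim: n => [|n [b fb]]; first by exists (@lpa_ghost k E); apply: frame_edges.
by eexists; rewrite intS; apply: frame_comp (frame_edges k hE) fb.
Qed.

(** The map nu only moves the brackets in a string of edges, which does not change
    their product. *)
Lemma lin_ext_nu n f :
  lin_ext (pair_mul (@lpa_path n) (@lpa_edge k E)) (nu f) =
  lin_ext (pair_mul (@lpa_edge k E) (@lpa_path n)) f.
Proof.
elim: n f => [//|n IHn] f; rewrite [LHS]lin_ext_tassocV.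
have [b fp] := frame_path n.
have fpe := frame_comp fp (frame_edges k hE).
rewrite lin_ext_tmap; last first.
  apply: (matched_idem (u := @lpa_vert k E)); first exact: lpa_edge_rng.
  exact: frame_srcl fpe.
apply: eq_lin_ext => p; rewrite /pair_mul lin_ext_basis IHn lin_ext_basis.
by [].
Qed.

End Paths.

Section Conjugation.

Variables (k : fieldType) (F : graph) (V W : finType) (X : edgeset V W).
Variables (m n : int) (a b a' b' : X -> lpa k F) (P P' : V -> lpa k F) (Q : W -> lpa k F).
Hypotheses (fr : frame m a b P Q) (fr' : frame n a' b' P' Q).

(** In terms of modules, the composite of the isomorphism given by one frame with
    the inverse of that given by the other. *)
Lemma frame_change_unit : (\sum_x a x * b' x) * (\sum_x a' x * b x) = 1.
Proof.
case: (fr) => ba _ _ _; case: (fr') => ba' _ _ _.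
rewrite -(frame_sum fr) mulr_suml; apply: eq_bigr => x _.
rewrite mulr_sumr (bigD1 x) //= big1 => [|y /negPf yx].
  by rewrite addr0 mulrA -[_ * b' x * _]mulrA ba' eqxx (frame_rngl fr).
by rewrite mulrA -[_ * b' x * _]mulrA ba' eq_sym yx mulr0 mul0r.
Qed.

Lemma frame_change x : (\sum_y a y * b' y) * a' x = a x.
Proof.
case: (fr') => ba' _ _ _; rewrite mulr_suml (bigD1 x) //= big1 => [|y /negPf yx].
  by rewrite addr0 -mulrA ba' eqxx (frame_rngl fr).
by rewrite -mulrA ba' yx mulr0.
Qed.

Lemma frame_ext y z : (forall x, y * a x = z * a x) -> y = z.
Proof.
move=> yz; rewrite -[y]mulr1 -[z]mulr1 -(frame_sum fr) !mulr_sumr.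
by apply: eq_bigr => x _; rewrite !mulrA yz.
Qed.

End Conjugation.

(** The products z_gh = psi(a_g) c_h and the elements om_gh, the path combinations
    omega_E(g (x) h), are two frames over G (x) H. Let u be the unit with
    u om_gh = z_gh. An edge e multiplies om_gh from the left through nu, and the
    element psi(phi(e)) multiplies z_gh through sigma_G and then sigma_H; the
    alignment equation says that the two coincide, so psi(phi(e)) u = u e. For
    vertices the equality is that of source idempotents, and ghost edges follow
    since they are determined by the edges. *)
Lemma aligned_conj (k : fieldType) (E F : graph) (hE : no_sinks E)
    (G : edgeset (vert E) (vert F)) (H : edgeset (vert F) (vert E))
    (n : nat) (omE : {linear k<<ecomp G H>> -> k<<tpow (edges E) n>>})
    (sgG : {linear k<<ecomp (edges E) G>> -> k<<ecomp G (edges F)>>})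
    (sgH : {linear k<<ecomp (edges F) H>> -> k<<ecomp H (edges E)>>})
    d a b d' c c'
    (phi : {rmorphism lpa k E -> lpa k F}) (psi : {rmorphism lpa k F -> lpa k E}) :
  bimod_iso omE ->
  tmap omE idfun \o @tassocV _ _ _ _ _ _ _ _ \o tmap idfun sgH
    \o @tassoc _ _ _ _ _ _ _ _ \o tmap sgG idfun
    =1 @nu _ _ (edges E) n \o tmap idfun omE \o @tassoc _ _ _ _ _ _ _ _ ->
  frame d a b (fun v => phi (lpa_vert k v)) (@lpa_vert k F) ->
  frame d' c c' (fun v => psi (lpa_vert k v)) (@lpa_vert k E) ->
  (forall p : ecomp (edges E) G, phi (lpa_edge k (val p).1) * a (val p).2 =
     lin_ext (pair_mul a (@lpa_edge k F)) (sgG (basis k p))) ->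
  scalable phi -> scalable psi -> (forall m x, lpa_deg m x -> lpa_deg m (psi x)) ->
  (forall p : ecomp (edges F) H, psi (lpa_edge k (val p).1) * c (val p).2 =
     lin_ext (pair_mul c (@lpa_edge k E)) (sgH (basis k p))) ->
  exists u v : lpa k E,
    [/\ u * v = 1, v * u = 1 & forall x, psi (phi x) * u = u * x].
Proof.
move=> omi align fa fc phie phiZ psiZ psideg psie.
have [b0 fp] := frame_path k hE n.
have [om' fo] := frame_transport omi fp.
have fz := frame_comp (frame_map psideg fa) fc.
set om := (fun p => lin_ext _ _) in fo.
set z := pair_mul _ _ in fz; set z' := (fun p => _) in fz.
pose u := \sum_p z p * om' p; pose v := \sum_p om p * z' p.
exists u, v; split; [exact: frame_change_unit fz fo|exact: frame_change_unit fo fz|].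
have uom p : u * om p = z p by exact: frame_change fz fo p.
have psi_lin (V' W' : finType) (X : edgeset V' W') (h : X -> lpa k F) f :
    psi (lin_ext h f) = lin_ext (fun x => psi (h x)) f.
  by rewrite rmorph_sum; apply: eq_bigr => x _; apply: psiZ.
have ghost_sum : \sum_e lpa_edge k e * lpa_ghost k e = 1 :> lpa k E.
  exact: frame_sum (frame_edges k hE).
have ce x : psi (phi (lpa_edge k x)) * u = u * lpa_edge k x.
  apply: (frame_ext fo) => p; rewrite -!mulrA uom.
  (* If e and g are not composable, both sides vanish. *)
  case: (eqVneq (src p) (rng x)) => px; last first.
    rewrite -[in RHS]lpa_edge_rng -[in RHS]mulrA (frame_srcl fo) (negPf px) !mulr0.
    rewrite -[in LHS]lpa_edge_rng !rmorphM -mulrA.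
    by rewrite (frame_srcl fz) (negPf px) mulr0.
  have xg : rng x == src (val p).1 by rewrite eq_sym; apply/eqP.
  pose q1 : ecomp (edges E) G := Sub (x, (val p).1) xg.
  have gh : rng q1 == src (val p).2 by exact: valP p.
  pose q : ecomp (ecomp (edges E) G) H := Sub (q1, (val p).2) gh.
  have qE : tassoc (basis k q) = basis k (Sub (x, p) (xg : rng x == src p) : ecomp (edges E) (ecomp G H)).
    by rewrite /tassoc lin_ext_basis /= tens_basis_val (@tens_basis k _ _ _ (edges E) (ecomp G H) x p xg).
  transitivity (lin_ext (pair_mul (pair_mul (psi \o a) (psi \o @lpa_edge k F)) c)
                 (tmap sgG idfun (basis k q))).
    rewrite lin_ext_tmap; last first.
      apply: (matched_idem (u := fun v => psi (lpa_vert k v))) => [r|w h].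
        by rewrite /pair_mul /= -mulrA -rmorphM lpa_edge_rng.
      by rewrite (frame_srcl fc).
    rewrite lin_ext_basis /z /pair_mul /= lin_ext_basis mulrA -rmorphM.
    by rewrite (phie q1) psi_lin; congr (_ * _); apply: eq_lin_ext => r; rewrite rmorphM.
  (* The alignment equation, evaluated at the basis vector e (x) g (x) h. *)
  have ext : lpa_edge k x * om p = lin_ext (pair_mul om (@lpa_edge k E))
      ((@tassocV _ _ _ _ _ _ _ _ \o tmap idfun sgH
        \o @tassoc _ _ _ _ _ _ _ _ \o tmap sgG idfun) (basis k q)).
    have -> : lpa_edge k x * om p = lin_ext (pair_mul (@lpa_edge k E) om)
        (tassoc (basis k q)) by rewrite qE lin_ext_basis.
    transitivity (lin_ext (pair_mul (@lpa_edge k E) (@lpa_path k E n))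
        (tmap idfun omE (tassoc (basis k q)))).
      rewrite lin_ext_tmap; last first.
        apply: (matched_idem (u := @lpa_vert k E)); first exact: lpa_edge_rng.
        exact: frame_srcl fp.
      by apply: eq_lin_ext => r; rewrite /pair_mul lin_ext_basis.
    rewrite -(lin_ext_nu hE) -[nu _](align (basis k q)) lin_ext_tmap; last first.
      apply: (matched_idem (u := @lpa_vert k E)); first exact: frame_rngl fp.
      exact: frame_srcl (frame_edges k hE).
    by apply: eq_lin_ext => r; rewrite /pair_mul lin_ext_basis.
  rewrite ext {1}/lin_ext mulr_sumr.
  under [RHS]eq_bigr => r _ do rewrite -lpa_scalerAr {1}/pair_mul mulrA uom.
  rewrite -[RHS]/(lin_ext (pair_mul z (@lpa_edge k E)) _) [RHS]lin_ext_tassocV /=.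
  rewrite lin_ext_tmap; last first.
    apply: (matched_idem (u := fun v => psi (lpa_vert k v))) => [r|w r].
      by rewrite /= -rmorphM (frame_rngl fa).
    by rewrite /pair_mul mulrA (frame_srcl fc) /=; case: ifP; rewrite ?mul0r.
  rewrite -[LHS]lin_ext_tassoc; apply: eq_lin_ext => r; rewrite /pair_mul lin_ext_basis.
  by rewrite -psie.
have cv w : psi (phi (lpa_vert k w)) * u = u * lpa_vert k w.
  apply: (frame_ext fo) => p; rewrite -!mulrA uom (frame_srcl fo).
  by rewrite (frame_srcl fz); case: ifP; rewrite ?uom ?mulr0.
move=> x; elim/lpa_gen_ind: x => [w|x|x||x y IHx IHy|s x IHx|x y IHx IHy].
- exact: cv.
- exact: ce.
  (* Insert the unit as the sum of the f f^* after u, and move each f through u. *)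
- rewrite -[LHS]mulr1 -ghost_sum mulr_sumr (bigD1 x) //= big1 => [|y /negPf yx].
    rewrite addr0 mulrA -[_ * u * _]mulrA -ce mulrA -!rmorphM lpa_ghost_edge eqxx.
    by rewrite cv -mulrA lpa_rng_ghost.
  rewrite mulrA -[_ * u * _]mulrA -ce mulrA -!rmorphM lpa_ghost_edge eq_sym yx.
  by rewrite !rmorph0 !mul0r.
- by rewrite !rmorph0 mulr0 mul0r.
- by rewrite !rmorphD mulrDl mulrDr IHx IHy.
- by rewrite phiZ psiZ -lpa_scalerAl -lpa_scalerAr IHx.
- by rewrite !rmorphM -mulrA IHy !mulrA IHx.
Qed.

Lemma conj_bij (T : pzRingType) (f : T -> T) (u v : T) :
  u * v = 1 -> v * u = 1 -> (forall x, f x * u = u * x) -> bijective f.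
Proof.
move=> uv vu fu; have fE x : f x = u * x * v by rewrite -fu -mulrA uv mulr1.
exists (fun y => v * y * u) => x; rewrite fE !mulrA.
  by rewrite vu mul1r -mulrA vu mulr1.
by rewrite uv mul1r -mulrA uv mulr1.
Qed.

(** The right-hand bijection provides surjectivity of f, the left-hand one a left
    inverse. *)
Lemma bij_of_comp (A B : Type) (f : A -> B) (g : B -> A) :
  bijective (g \o f) -> bijective (f \o g) -> bijective f.
Proof.
move=> [h hK Kh] [h' h'K Kh'].
exists (h \o g) => [|y] /=; first exact: hK.
by rewrite -(Kh' y) /=; congr f; apply: hK.
Qed.

Lemma rmorph_inv (T T' : pzRingType) (f : {rmorphism T -> T'}) :
  bijective f -> exists g : {rmorphism T' -> T}, cancel f g /\ cancel g f.
Proof.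
move=> [g fK gK].
have gD : zmod_morphism g by move=> x y; apply: (can_inj fK); rewrite rmorphB !gK.
have gM : monoid_morphism g.
  split=> [|x y]; apply: (can_inj fK); first by rewrite gK rmorph1.
  by rewrite rmorphM !gK.
pose g' : {rmorphism T' -> T} := HB.pack g
  (GRing.isZmodMorphism.Build _ _ _ gD) (GRing.isMonoidMorphism.Build _ _ _ gM).
by exists g'.
Qed.

(** If f x is homogeneous of degree n, then it equals f y for the component y of
    x of degree n. *)
Lemma graded_inj_deg (V V' : zmodType) (deg : int -> V -> Prop)
    (deg' : int -> V' -> Prop) (f : {additive V -> V'}) :
  is_grading deg -> is_grading deg' -> injective f ->
  (forall n x, deg n x -> deg' n (f x)) ->
  forall n x, deg n x <-> deg' n (f x).
Proof.
move=> gr gr' f_inj fdeg n x; split=> [|fx]; first exact: fdeg.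
have [y [yn [s [g [us ns gdeg gy xE]]]]] := homog_part gr x n.
suff -> : x = y by [].
apply: f_inj; rewrite -gy; apply: (homog_eq gr' us ns (f := f \o g)) => //.
  by move=> m; apply: fdeg.
by rewrite xE raddf_sum.
Qed.

(** Alignment at E makes psi o phi a conjugation, alignment at F makes phi o psi
    one. *)
Lemma aligned_mse_graded_iso (k : fieldType) (E F : graph) (hE : no_sinks E) (hF : no_sinks F)
    (G : edgeset (vert E) (vert F)) (H : edgeset (vert F) (vert E))
    d a b P d' c c' Q :
  aligned_mse k G H ->
  @frame k F _ _ G d a b P (@lpa_vert k F) ->
  @frame k E _ _ H d' c c' Q (@lpa_vert k E) ->
  exists (phi : {rmorphism lpa_gr k E -> lpa_gr k F})
         (phi' : {rmorphism lpa_gr k F -> lpa_gr k E}),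
    graded_iso phi phi' /\
    frame d a b (fun v => phi (lpa_vert k v)) (@lpa_vert k F).
Proof.
move=> [n [omE [omF [sgG [sgH [[iE iF iG iH] alE alF]]]]]] fa fc.
have [phi [phiZ phideg fa' phie]] := edge_hom hF iG fa.
have [psi [psiZ psideg fc' psie]] := edge_hom hE iH fc.
have [u [v [uv vu uE]]] :=
  aligned_conj hE iE alE fa' fc' phie phiZ psiZ psideg psie.
have [u' [v' [uv' vu' uF]]] :=
  aligned_conj hF iF alF fc' fa' psie psiZ phiZ phideg phie.
have bphi : bijective phi.
  by apply: (@bij_of_comp _ _ phi psi);
    [apply: conj_bij uv vu _ | apply: conj_bij uv' vu' _].
have [phi' [phiK phi'K]] := rmorph_inv bphi.
exists phi, phi'; split=> //; split=> //.
apply: (graded_inj_deg (lpa_grading k E) (lpa_grading k F)) => //.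
exact: bij_inj.
Qed.

(** * Counting edges and existence of frames *)

Definition count_mx (V W : finType) (X : edgeset V W) : 'M[nat]_(#|V|, #|W|) :=
  \matrix_(i, j) #|[set x : X | (src x == enum_val i) && (rng x == enum_val j)]|.

Lemma sum_enum_val (R : nmodType) (T : finType) (f : T -> R) :
  \sum_(i < #|T|) f (enum_val i) = \sum_x f x.
Proof.
rewrite [RHS](reindex_onto (enum_val : 'I_#|T| -> T) enum_rank) /=.
  by apply: eq_bigl => i; rewrite enum_valK eqxx.
by move=> x _; rewrite enum_rankK.
Qed.

Lemma count_mxE (V W : finType) (X : edgeset V W) i j :
  count_mx X i j = \sum_(x : X | src x == enum_val i) (rng x == enum_val j)%:R.
Proof.
rewrite mxE cardsE -sum1_card big_mkcondr /= -[LHS]/(\sum_(x | _) _)%R.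
by apply: eq_bigr => x _; case: eqP.
Qed.

Lemma count_mx_ecomp (U V W : finType) (X : edgeset U V) (Y : edgeset V W) :
  count_mx (ecomp X Y) = count_mx X *m count_mx Y.
Proof.
apply/matrixP => i j; rewrite count_mxE mxE.
rewrite (big_ecomp _ (fun x => src x == enum_val i)
  (fun _ y => (rng y == enum_val j)%:R)) /=.
under [RHS]eq_bigr => l _ do rewrite (count_mxE X) mulr_suml.
rewrite [RHS]exchange_big /=; apply: eq_bigr => x _.
under [RHS]eq_bigr => l _ do rewrite count_mxE.
rewrite (sum_enum_val (fun v => (rng x == v)%:R *
   \sum_(y : Y | src y == v) (rng y == enum_val j)%:R)).
rewrite (bigD1 (rng x)) //= eqxx mul1r [X in _ = _ + X]big1 ?addr0 // => v /negPf xv.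
by rewrite eq_sym xv mul0r.
Qed.

Lemma count_mx_mx_edges (V W : finType) (R : 'M[nat]_(#|V|, #|W|)) :
  count_mx (mx_edges R) = R.
Proof.
apply/matrixP => i j; rewrite mxE cardsE -sum1_card.
pose C (vw : V * W) := (vw.1 == enum_val i) && (vw.2 == enum_val j).
transitivity (\sum_(vw | C vw) \sum_(l < R (enum_rank vw.1) (enum_rank vw.2)) 1)%N.
  by rewrite sig_big_dep; apply: eq_bigl => x; rewrite /= andbT.
rewrite (big_pred1 (enum_val i, enum_val j)) => [|[v w]].
  by rewrite sum1_card card_ord !enum_valK.
by rewrite /C /= -pair_eqE.
Qed.

(** The restriction of h to edges from v to w is invertible, so its matrix is
    square. *)
Lemma bimod_iso_count_mx (k : fieldType) (V W : finType) (X Y : edgeset V W)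
    (h : {linear k<<X>> -> k<<Y>>}) : bimod_iso h -> count_mx X = count_mx Y.
Proof.
suff le (X' Y' : edgeset V W) (f : {linear k<<X'>> -> k<<Y'>>}) i j :
    bimod_iso f -> (count_mx X' i j <= count_mx Y' i j)%N.
  move=> hi; have [g [gi _ _]] := bimod_iso_inv hi.
  by apply/matrixP => i j; apply/eqP; rewrite eqn_leq (le _ _ _ _ _ hi) (le _ _ _ _ _ gi).
move=> fi; have [g [gi fK gK]] := bimod_iso_inv fi.
rewrite !mxE; set A := [set x | _]; set B := [set y | _].
pose M : 'M[k]_(#|A|, #|B|) :=
  \matrix_(r, s) f (basis k (enum_val r)) (enum_val s).
pose N : 'M[k]_(#|B|, #|A|) :=
  \matrix_(s, r) g (basis k (enum_val s)) (enum_val r).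
(* M N is the identity because edges outside B do not contribute. *)
apply: (@mulmx1_min k _ _ M N); apply/matrixP => r s.
rewrite !mxE; under eq_bigr => l _ do rewrite !mxE.
rewrite -(big_enum_val (fun y => f (basis k (enum_val r)) y * g (basis k y) (enum_val s))).
have := linear_basis_comp f g (enum_val r) (enum_val s).
rewrite fK ffunE (inj_eq enum_val_inj) eq_sym => ->.
rewrite big_mkcond /=; apply: eq_bigr => y _; case: ifPn => // yB.
case: (eqVneq (f (basis k (enum_val r)) y) 0) => [->|nz]; first by rewrite mul0r.
have [sy ry] := bimod_iso_basis fi nz.
have := enum_valP r; rewrite !inE in yB *; rewrite -sy -ry.
by rewrite (negPf yB).
Qed.

Lemma count_mx_tpow (V : finType) (X : edgeset V V) n :
  count_mx (tpow X n) = count_mx X ^+ n.+1.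
Proof.
elim: n => [|n IHn]; first by rewrite expr1.
by rewrite exprS -IHn; apply: count_mx_ecomp.
Qed.

(** Multiplying by the row of ones forgets the sources. *)
Lemma const_mul_count_mx (V W : finType) (X : edgeset V W) i j :
  ((const_mx 1 : 'rV[nat]_#|V|) *m count_mx X) i j = #|[set x : X | rng x == enum_val j]|.
Proof.
rewrite mxE; under eq_bigr => l _ do rewrite mxE mul1r count_mxE.
rewrite (sum_enum_val (fun v => \sum_(x : X | src x == v) (rng x == enum_val j)%:R)).
transitivity (\sum_(x : X) (rng x == enum_val j)%:R : nat).
  by rewrite [RHS](partition_big (fun x : X => src x) xpredT).
rewrite cardsE -sum1_card -[RHS]/(\sum_(x | _) _)%R [RHS]big_mkcond /=.
by apply: eq_bigr => x _; rewrite -[_ \in _]/(rng x == enum_val j); case: eqP.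
Qed.

Lemma fiber_bij (A B W : finType) (f : A -> W) (g : B -> W) :
  (forall w, #|[set x | f x == w]| = #|[set y | g y == w]|) ->
  exists t : A -> B, bijective t /\ forall x, g (t x) = f x.
Proof.
move=> fg; have cAB : #|B| = #|A|.
  have c (T : finType) (h : T -> W) : #|T| = (\sum_w #|[set x | h x == w]|)%N.
    rewrite -sum1_card (partition_big h xpredT) //=; apply: eq_bigr => w _.
    by rewrite -sum1_card; apply: eq_bigl => x; rewrite inE.
  by rewrite (c _ f) (c _ g); apply: eq_bigr.
(* The list lookup below needs a default value y0 in B. *)
case: (pickP (@predT B)) => [y0 _|B0]; last first.
  have B0F : B -> False by move=> y; have := B0 y.
  have A0 : A -> False.
    move=> x; have : (0 < #|A|)%N by apply/card_gt0P; exists x.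
    by rewrite -cAB (eq_card0 B0).
  exists (fun x => False_rect _ (A0 x)); split=> [|x]; last by case: (A0 x).
  by exists (fun y => False_rect _ (B0F y)) => [x|y];
    [case: (A0 x) | case: (B0F y)].
pose fa w := enum [set x | f x == w]; pose fb w := enum [set y | g y == w].
pose t x := nth y0 (fb (f x)) (index x (fa (f x))).
have xfa x : x \in fa (f x) by rewrite mem_enum inE.
have ix x : (index x (fa (f x)) < size (fb (f x)))%N.
  by rewrite -cardE -fg cardE index_mem.
have gt x : g (t x) = f x.
  by have := mem_nth y0 (ix x); rewrite mem_enum inE => /eqP.
exists t; split=> //; apply: inj_card_bij; last by rewrite cAB.
move=> x y txy; have fxy : f x = f y by rewrite -!gt txy.
have := ix y; have := ix x; have := xfa y; have := xfa x; move: txy; rewrite /t -fxy.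
move=> /eqP txy xf yf xi yi; rewrite nth_uniq ?enum_uniq // in txy.
by rewrite -(nth_index x xf) (eqP txy) nth_index.
Qed.

(** By hypothesis there is a range preserving bijection t from the pairs (x, q),
    q a path of n + 1 edges, to the paths of m + 1 edges. The pairs thus inherit
    the frame of paths, and division by the frame of the paths q gives
    a_x = sum over q of t(x, q) q^*. The source idempotents are whatever comes
    out. *)
Lemma frame_exists (k : fieldType) (F : graph) (hF : no_sinks F) (V : finType)
    (X : edgeset V (vert F)) (m n : nat) :
  (const_mx 1 : 'rV[nat]_#|V|) *m (count_mx X *m adj F ^+ n.+1) =
    const_mx 1 *m adj F ^+ m.+1 ->
  exists a b P, frame (m%:Z - n%:Z) a b P (@lpa_vert k F) (X := X).
Proof.
rewrite -[adj F]/(count_mx (edges F)) -!count_mx_tpow -count_mx_ecomp => hmn.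
have [t [tbij tr]] : exists t : ecomp X (tpow (edges F) n) -> tpow (edges F) m,
    bijective t /\ forall p, rng (t p) = rng p.
  apply: fiber_bij => w; have /matrixP/(_ 0 (enum_rank w)) := hmn.
  by rewrite !const_mul_count_mx enum_rankK.
have [b fm] := frame_path k hF m; have [y' fn] := frame_path k hF n.
case: (fm) => ba sP P1 ab.
pose c p := lpa_path k (t p); pose c' p := b (t p).
pose P v := \sum_(p | src p == v) c p * c' p.
have fc : frame m.+1%:Z c c' P (@lpa_vert k F).
  split=> [p q|//||p]; last exact: ab.
    by rewrite ba (inj_eq (bij_inj tbij)) tr.
  rewrite -(frame_sum fm) [RHS](reindex t) /=; last exact: onW_bij.
  by rewrite [RHS](partition_big (fun p : ecomp X _ => src p) xpredT).
have := frame_quot fc fn; rewrite (_ : m.+1%:Z - n.+1%:Z = m%:Z - n%:Z).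
  by move=> fq; do 3!eexists; exact: fq.
by rewrite -!natz -[m.+1]addn1 -[n.+1]addn1 !natrD opprD addrACA subrr addr0.
Qed.

(** * Graded modules and the graded Grothendieck group along an isomorphism *)

(** The action is one of the converse ring, where the product is reversed. *)
Lemma rmulA (T : pzRingType) (M : lmodType T^c) (x : M) (s t : T) :
  rmul x (s * t) = rmul (rmul x s) t.
Proof. exact/esym/(scalerA (t : T^c) (s : T^c) x). Qed.

Section Restriction.

Variables (T T' : pzRingType) (f : {rmorphism T' -> T}) (M : lmodType T^c).

(** The module M with scalars restricted along f; the alias carries f so that the
    two module structures on one carrier are kept apart. *)
Definition restr of {rmorphism T' -> T} : Type := M.
Local Notation N := (restr f).

HB.instance Definition _ := GRing.Zmodule.on N.

Definition restr_scale (t : T'^c) (x : N) : N := (f t : T^c) *: (x : M).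

Let scaleA t s x : restr_scale t (restr_scale s x) = restr_scale (t * s) x.
Proof.
rewrite /restr_scale scalerA; congr (_ *: _); exact: esym (rmorphM f s t).
Qed.
Let scale1 : left_id 1 restr_scale.
Proof. by move=> x; rewrite /restr_scale rmorph1 scale1r. Qed.
Let scaleDr : right_distributive restr_scale +%R.
Proof. by move=> t x y; apply: scalerDr. Qed.
Let scaleDl x : {morph restr_scale^~ x : s t / s + t}.
Proof. by move=> s t; rewrite /restr_scale rmorphD; apply: scalerDl. Qed.

HB.instance Definition _ :=
  GRing.Zmodule_isLmodule.Build T'^c N scaleA scale1 scaleDr scaleDl.

Lemma restr_rmul (x : N) (t : T') : rmul x t = rmul (x : M) (f t).
Proof. by []. Qed.

End Restriction.

Section GradedRestriction.

Variables (T T' : grring) (f : {rmorphism T' -> T}).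
Hypothesis fdeg : forall n t, gr_deg n t -> gr_deg n (f t).

Lemma restr_grading (M : grmod T) :
  is_grading ((@gm_deg T M : int -> restr M f -> Prop)).
Proof. exact: gm_grading M. Qed.

Lemma restr_deg (M : grmod T) m n (x : restr M f) (t : T') :
  gm_deg m (x : M) -> gr_deg n t -> gm_deg (m + n) (rmul x t : M).
Proof. by move=> xm tn; apply: gm_rmul => //; apply: fdeg. Qed.

Definition gr_restr (M : grmod T) : grmod T' :=
  GrMod (restr_grading M) (@restr_deg M).

End GradedRestriction.

Section LinearRestriction.

Variables (T T' : pzRingType) (f : {rmorphism T' -> T}) (M N : lmodType T^c).

Lemma restr_linear_subproof (h : {linear M -> N}) :
  linear (h : restr M f -> restr N f).
Proof. by move=> t x y; apply: (linearP h). Qed.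

Definition restr_linear (h : {linear M -> N}) : {linear restr M f -> restr N f} :=
  HB.pack (h : restr M f -> restr N f)
    (GRing.isLinear.Build _ _ _ _ _ (restr_linear_subproof h)).

End LinearRestriction.

Section K0Facts.

Variable T : grring.

Lemma fgp_shift_iso (P Q : fgproj T) : fgp_iso P Q -> fgp_iso (fgp_shift P) (fgp_shift Q).
Proof. by move=> [f [fbij fdeg]]; exists f; split=> // n x; apply: fdeg. Qed.

Lemma vgr_shiftE (P : fgproj T) : vgr_shift (vgr_class P) = vgr_class (fgp_shift P).
Proof.
apply/(clsP _ _ (@fgp_iso_equiv T))/fgp_shift_iso; exact: rep_cls (@fgp_iso_equiv T).
Qed.

Lemma vgr_repr (a : vgr T) : exists P, a = vgr_class P.
Proof. by exists (rep a); rewrite /vgr_class repK. Qed.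

Lemma K0_repr (a : K0gr T) : exists P Q, a = cls (@k0_rel T) (vgr_class P, vgr_class Q).
Proof.
have [P PE] := vgr_repr (rep a).1; have [Q QE] := vgr_repr (rep a).2.
by exists P, Q; rewrite -PE -QE -surjective_pairing repK.
Qed.

Lemma vgr_addCA : left_commutative (@vgr_add T).
Proof. by move=> a b c; rewrite !vgr_addA (vgr_addC a). Qed.

Lemma vgr_addACA : interchange (@vgr_add T) (@vgr_add T).
Proof. by move=> a b c d; rewrite -!vgr_addA (vgr_addCA b). Qed.

Lemma K0_addE p q : K0_add (cls (@k0_rel T) p) (cls (@k0_rel T) q) =
  cls (@k0_rel T) (vgr_add p.1 q.1, vgr_add p.2 q.2).
Proof.
rewrite /K0_add; apply/(clsP _ _ (@k0_rel_equiv T)).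
have := rep_cls q (@k0_rel_equiv T); have := rep_cls p (@k0_rel_equiv T).
move: (rep _) (rep _) => s r [c /= cE] [d /= dE].
exists (vgr_add c d) => /=.
rewrite (vgr_addACA r.1 s.1) (vgr_addACA p.1 q.1).
rewrite (vgr_addACA _ (vgr_add s.1 q.2)) (vgr_addACA _ (vgr_add q.1 s.2)).
by rewrite cE dE.
Qed.

Lemma vgr_shift_add (a b : vgr T) :
  vgr_shift (vgr_add a b) = vgr_add (vgr_shift a) (vgr_shift b).
Proof.
have [P ->] := vgr_repr a; have [Q ->] := vgr_repr b.
rewrite vgr_addE !vgr_shiftE vgr_addE; apply/(clsP _ _ (@fgp_iso_equiv T)).
pose h (x : fgp_shift (fgp_sum P Q)) : fgp_sum (fgp_shift P) (fgp_shift Q) := x.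
have hL : linear h by [].
exists (HB.pack h (GRing.isLinear.Build _ _ _ _ _ hL)
        : {linear fgp_shift (fgp_sum P Q) -> fgp_sum (fgp_shift P) (fgp_shift Q)}).
by split=> //; exists id.
Qed.

Lemma K0_shiftE p :
  K0_shift (cls (@k0_rel T) p) = cls (@k0_rel T) (vgr_shift p.1, vgr_shift p.2).
Proof.
rewrite /K0_shift; apply/(clsP _ _ (@k0_rel_equiv T)).
have [c /(congr1 (@vgr_shift T)) cE] := rep_cls p (@k0_rel_equiv T).
by exists (vgr_shift c); move: cE; rewrite !vgr_shift_add.
Qed.

Lemma fgp_sum0 (P : fgproj T) : fgp_iso (fgp_sum P (fgp_zero T)) P.
Proof.
pose h (x : fgp_sum P (fgp_zero T)) : P := x.1.
have hL : linear h by [].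
exists (HB.pack h (GRing.isLinear.Build _ _ _ _ _ hL)
        : {linear fgp_sum P (fgp_zero T) -> P}).
split=> [|n x]; last by split=> [[]|].
exists (fun x => (x, 0)) => // -[x y] /=; congr pair.
by rewrite [RHS]thinmx0 [LHS]thinmx0.
Qed.

Lemma vgr_add0 a : vgr_add a (vgr_class (fgp_zero T)) = a.
Proof.
have [P ->] := vgr_repr a; rewrite vgr_addE.
by apply/(clsP _ _ (@fgp_iso_equiv T))/fgp_sum0.
Qed.

Lemma K0_class_sum (P Q : fgproj T) :
  K0_class (fgp_sum P Q) = K0_add (K0_class P) (K0_class Q).
Proof.
rewrite K0_addE /= !vgr_addE -(vgr_addE (fgp_zero T)) vgr_add0.
apply/(clsP _ _ (@k0_rel_equiv T)).
by exists (vgr_class (fgp_zero T)); rewrite /= vgr_add0.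
Qed.

End K0Facts.

Section IsoRestriction.

Variables (T T' : grring) (xi : {rmorphism T -> T'}) (xi' : {rmorphism T' -> T}).
Hypotheses (xiK : cancel xi xi') (xi'K : cancel xi' xi).
Hypothesis xideg : forall n t, gr_deg n t -> gr_deg n (xi t).
Hypothesis xi'deg : forall n t, gr_deg n t -> gr_deg n (xi' t).

Local Notation res := (gr_restr xi'deg).
Local Notation ext := (gr_restr xideg).

Lemma restr_fg (M : grmod T) : fg M -> fg (res M).
Proof.
move=> [n [g gE]]; exists n, g => x; have [c ->] := gE x.
by exists (fun i => xi (c i)); apply: eq_bigr => i _; rewrite restr_rmul xiK.
Qed.

(** A lifting problem over T' becomes one over T by restriction along the inverse
    isomorphism, and its solution over T is linear over T'. *)
Lemma restr_proj (M : grmod T) : gr_projective M -> gr_projective (res M).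
Proof.
move=> pM X Y p g pdeg psurj gdeg.
have gL : linear (g : M -> ext Y).
  move=> t x y; rewrite -[X in _ = X + _]/(_ *: _).
  have := linearP g (xi t) x y.
  by rewrite -[_ *: (x : res M)]/((xi' (xi t) : T^c) *: (x : M)) xiK.
have [h [hdeg hE]] := pM (ext X) (ext Y) (restr_linear xi p)
    (HB.pack (g : M -> ext Y) (GRing.isLinear.Build _ _ _ _ _ gL)) pdeg psurj gdeg.
have hL : linear (h : res M -> X).
  move=> t x y; have := linearP h (xi' t) x y.
  by rewrite -[_ *: (h x)]/((xi (xi' t) : T'^c) *: (h x : X)) xi'K.
by exists (HB.pack (h : res M -> X) (GRing.isLinear.Build _ _ _ _ _ hL) : {linear res M -> X}).
Qed.

Definition fgp_restr (P : fgproj T) : fgproj T' :=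
  FGProj (restr_fg (fgp_fg P)) (restr_proj (fgp_proj (f := P))).

Lemma fgp_restr_iso (P Q : fgproj T) :
  fgp_iso P Q -> fgp_iso (fgp_restr P) (fgp_restr Q).
Proof. by move=> [f [fbij fdeg]]; exists (restr_linear xi' f). Qed.

Definition restr_mul (X : grmod T) (x : X) (t : T') : res X := rmul (x : res X) t.

(** Since xi is invertible, the pure tensor x (x) t equals (x xi'(t)) (x) 1. So the
    tensor product is X itself. *)
Lemma restr_extension (X : grmod T) : is_gr_extension xi (@restr_mul X).
Proof.
split=> [|x t s|m n x t xm tn]; last first.
- by apply: gm_rmul (xm : gm_deg m (x : res X)) tn.
- exact: rmulA.
split.
  split=> [x x' t|x t t'|x t t'].
  - exact: scalerDr.
  - exact: scalerDl.
  - rewrite /restr_mul !restr_rmul rmorphM xiK.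
    by rewrite rmulA.
move=> Q g [gDl gDr gB].
have gD : zmod_morphism (fun x : res X => g x 1).
  move=> x y; apply/eqP; rewrite eq_sym subr_eq -gDl.
  by rewrite -[x - y + y]/((x - y : res X) + y) subrK.
exists (HB.pack (fun x : res X => g x 1) (GRing.isZmodMorphism.Build _ _ _ gD)
        : {additive res X -> Q}); split=> [x t|h' h'E x].
  by rewrite /= /restr_mul restr_rmul gB xi'K mulr1.
by rewrite /= -h'E /restr_mul /rmul scale1r.
Qed.

Definition vgr_restr (a : vgr T) : vgr T' := vgr_class (fgp_restr (rep a)).
Definition K0_restr (a : K0gr T) : K0gr T' :=
  cls (@k0_rel T') (vgr_restr (rep a).1, vgr_restr (rep a).2).

Lemma vgr_restrE (P : fgproj T) : vgr_restr (vgr_class P) = vgr_class (fgp_restr P).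
Proof.
apply/(clsP _ _ (@fgp_iso_equiv T'))/fgp_restr_iso; exact: rep_cls (@fgp_iso_equiv T).
Qed.

Lemma fgp_restr_sum (P Q : fgproj T) :
  fgp_iso (fgp_restr (fgp_sum P Q)) (fgp_sum (fgp_restr P) (fgp_restr Q)).
Proof.
pose h (x : fgp_restr (fgp_sum P Q)) : fgp_sum (fgp_restr P) (fgp_restr Q) := x.
have hL : linear h by [].
exists (HB.pack h (GRing.isLinear.Build _ _ _ _ _ hL)
        : {linear fgp_restr (fgp_sum P Q) -> fgp_sum (fgp_restr P) (fgp_restr Q)}).
by split=> //; exists id.
Qed.

Lemma fgp_restr_shift (P : fgproj T) :
  fgp_iso (fgp_restr (fgp_shift P)) (fgp_shift (fgp_restr P)).
Proof.
pose h (x : fgp_restr (fgp_shift P)) : fgp_shift (fgp_restr P) := x.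
have hL : linear h by [].
exists (HB.pack h (GRing.isLinear.Build _ _ _ _ _ hL)
        : {linear fgp_restr (fgp_shift P) -> fgp_shift (fgp_restr P)}).
by split=> //; exists id.
Qed.

Lemma fgp_restr_zero : fgp_iso (fgp_restr (fgp_zero T)) (fgp_zero T').
Proof.
pose h (x : fgp_restr (fgp_zero T)) : fgp_zero T' := 0.
have hL : linear h by move=> t x y; rewrite /h scaler0 addr0.
exists (HB.pack h (GRing.isLinear.Build _ _ _ _ _ hL)
        : {linear fgp_restr (fgp_zero T) -> fgp_zero T'}).
split=> //; exists (fun=> 0) => x /=.
  by apply/esym; rewrite [LHS]thinmx0; apply/esym; apply: thinmx0.
by rewrite /h; apply/esym; apply: thinmx0.
Qed.

Lemma vgr_restr_add a b : vgr_restr (vgr_add a b) = vgr_add (vgr_restr a) (vgr_restr b).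
Proof.
have [P ->] := vgr_repr a; have [Q ->] := vgr_repr b.
rewrite vgr_addE !vgr_restrE vgr_addE.
by apply/(clsP _ _ (@fgp_iso_equiv T'))/fgp_restr_sum.
Qed.

Lemma vgr_restr_shift a : vgr_restr (vgr_shift a) = vgr_shift (vgr_restr a).
Proof.
have [P ->] := vgr_repr a; rewrite vgr_shiftE !vgr_restrE vgr_shiftE.
by apply/(clsP _ _ (@fgp_iso_equiv T'))/fgp_restr_shift.
Qed.

Lemma K0_restrE p :
  K0_restr (cls (@k0_rel T) p) = cls (@k0_rel T') (vgr_restr p.1, vgr_restr p.2).
Proof.
rewrite /K0_restr; apply/(clsP _ _ (@k0_rel_equiv T')).
have [c /(congr1 vgr_restr) cE] := rep_cls p (@k0_rel_equiv T).
by exists (vgr_restr c); move: cE; rewrite !vgr_restr_add.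
Qed.

Lemma K0_restr_class (P : fgproj T) : K0_restr (K0_class P) = K0_class (fgp_restr P).
Proof.
rewrite K0_restrE /= !vgr_restrE /K0_class; congr (cls _ (_, _)).
by apply/(clsP _ _ (@fgp_iso_equiv T'))/fgp_restr_zero.
Qed.

Lemma K0_restr_shift a : K0_restr (K0_shift a) = K0_shift (K0_restr a).
Proof.
have [P [Q ->]] := K0_repr a.
by rewrite K0_restrE !K0_shiftE K0_restrE /= !vgr_restr_shift.
Qed.

Lemma K0_restr_is_map : is_K0_map xi K0_restr.
Proof.
split=> [a b|X].
  have [P [Q ->]] := K0_repr a; have [P' [Q' ->]] := K0_repr b.
  by rewrite K0_addE !K0_restrE K0_addE /= !vgr_restr_add.
exists (fgp_restr X), (@restr_mul X); split; last exact: K0_restr_class.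
exact: restr_extension.
Qed.

End IsoRestriction.

(** * Vertex modules under restriction *)

Section VertexModules.

Variables (k : fieldType) (F : graph).
Local Notation L := (lpa k F).

Lemma vL_projP w (y : L) : (lpa_vert k w * y : (L^c)^o) \in @vL_pred k F w.
Proof. by apply/eqP; rewrite mulrA lpa_vvE eqxx. Qed.

Definition vL_proj_to w (y : L) : vL k w := VL (vL_projP w y).

Lemma vL_valE w (x : vL k w) : lpa_vert k w * (vLval x : L) = (vLval x : L).
Proof. by apply/eqP; exact: (vLP x). Qed.

Lemma vL_proj_toK w (x : vL k w) : vL_proj_to w (vLval x : L) = x.
Proof. by apply: val_inj; apply: vL_valE. Qed.

Lemma vL_proj_linear w (y y' t : L) :
  vL_proj_to w (y * t + y') = rmul (vL_proj_to w y) t + vL_proj_to w y'.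
Proof.
apply: val_inj; rewrite /= -[RHS]/(lpa_vert k w * y * t + lpa_vert k w * y' : L).
by rewrite mulrDr mulrA.
Qed.

Definition vsum (s : seq (vert F)) : fgproj (lpa_gr k F) :=
  foldr (fun w P => fgp_sum (vL_fgp k w) P) (fgp_zero (lpa_gr k F)) s.

Variables (V : finType) (G : edgeset V (vert F)) (a b : G -> L) (P : V -> L).
Hypothesis fr : frame 0 a b P (@lpa_vert k F).

(** The isomorphism of right modules that a frame describes, restricted to the
    edges in s. *)
Fixpoint to_vsum (s : seq G) (y : L) : vsum (map (@rng _ _ G) s) :=
  match s return vsum (map (@rng _ _ G) s) with
  | [::] => 0
  | g :: s' => (vL_proj_to (rng g) (b g * y), to_vsum s' y)
  end.

Fixpoint of_vsum (s : seq G) : vsum (map (@rng _ _ G) s) -> L :=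
  match s return vsum (map (@rng _ _ G) s) -> L with
  | [::] => fun=> 0
  | g :: s' => fun x => a g * (vLval x.1 : L) + of_vsum x.2
  end.

Lemma to_vsum_linear s (y y' t : L) :
  to_vsum s (y * t + y') = rmul (to_vsum s y) t + to_vsum s y'.
Proof.
elim: s => [|g s IHs] /=; first by rewrite /rmul scaler0 addr0.
by rewrite mulrDr mulrA vL_proj_linear IHs.
Qed.

Lemma to_vsumK s y : of_vsum (to_vsum s y) = \sum_(g <- s) a g * b g * y.
Proof.
elim: s => [|g s IHs] /=; first by rewrite big_nil.
by rewrite big_cons -IHs mulrA (frame_rngl fr) mulrA.
Qed.

Lemma to_vsum_notin g s y : g \notin s -> to_vsum s (a g * y) = 0.
Proof.
case: (fr) => ba _ _ _; elim: s => [//|h s IHs] /=; rewrite inE negb_or => /andP[gh /IHs ->].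
rewrite [RHS]surjective_pairing /=; congr pair.
rewrite mulrA ba eq_sym (negPf gh) mul0r; apply: val_inj => /=.
by rewrite mulr0.
Qed.

Lemma of_vsum_notin g s (x : vsum (map (@rng _ _ G) s)) :
  g \notin s -> b g * of_vsum x = 0.
Proof.
case: (fr) => ba _ _ _; elim: s x => [|h s IHs] x /=; first by rewrite mulr0.
rewrite inE negb_or => /andP[/negPf gh /IHs gs].
by rewrite mulrDr gs mulrA ba gh mul0r addr0.
Qed.

(** For distinct edges b_g a_h = 0, so that the summands do not interfere; this is
    where the list must be free of repetitions. *)
Lemma of_vsumK s (x : vsum (map (@rng _ _ G) s)) :
  uniq s -> to_vsum s (of_vsum x) = x.
Proof.
case: (fr) => ba _ _ _; elim: s x => [|g s IHs] x /=; first by move=> _; rewrite [RHS]thinmx0.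
move=> /andP[gs /IHs us].
have -> : a g * vLval x.1 + of_vsum x.2 = a g * vLval x.1 * 1 + of_vsum x.2 :> L.
  by rewrite mulr1.
rewrite to_vsum_linear to_vsum_notin // us mulr1 mulrDr of_vsum_notin // addr0.
rewrite mulrA ba eqxx vL_valE vL_proj_toK [RHS]surjective_pairing; congr pair.
by rewrite /rmul scaler0 add0r.
Qed.

Lemma to_vsum_deg s n (y : L) : lpa_deg n y -> gm_deg n (to_vsum s y).
Proof.
move=> yn; elim: s => [//|g s IHs]; split=> //=.
case: (fr) => _ _ _ ab; case: (ab g) => _ bg.
rewrite -[n]add0r; apply: Dmul; first exact: Dvert.
by rewrite -[n]add0r -[X in X + _]oppr0; apply: Dmul.
Qed.

Lemma of_vsum_deg s n (x : vsum (map (@rng _ _ G) s)) :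
  gm_deg n x -> lpa_deg n (of_vsum x).
Proof.
elim: s x => [|g s IHs] x /=; first by move=> _; apply: Dzero.
case: (fr) => _ _ _ ab [x1 /IHs x2]; apply: Dadd => //.
by rewrite -[n]add0r; apply: Dmul => //; case: (ab g).
Qed.

End VertexModules.

Section VertexRestriction.

Variables (k : fieldType) (E F : graph).
Variables (phi : {rmorphism lpa_gr k E -> lpa_gr k F})
          (phi' : {rmorphism lpa_gr k F -> lpa_gr k E}).
Hypotheses (phiK : cancel phi phi') (phi'K : cancel phi' phi).
Hypothesis phideg : forall n t, lpa_deg n t -> lpa_deg n (phi t).
Hypothesis phi'deg : forall n t, lpa_deg n t -> lpa_deg n (phi' t).
Variables (G : edgeset (vert E) (vert F)) (a b : G -> lpa k F).
Hypothesis fr : frame 0 a b (fun v => phi (lpa_vert k v)) (@lpa_vert k F).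

Local Notation res := (@fgp_restr _ _ phi phi' phiK phi'K phideg phi'deg).

(** The module v L(E) is carried by phi to phi(v) L(F), and phi(v) is the sum of
    the a_g b_g over the edges g with source v. *)
Lemma restr_vertex v :
  fgp_iso (res (vL_fgp k v))
    (vsum k (map (@rng _ _ G) (enum [pred g : G | src g == v]))).
Proof.
set s := enum _; have us : uniq s by apply: enum_uniq.
have phiP x : \sum_(g <- s) a g * b g * x = phi (lpa_vert k v) * x.
  case: (fr) => _ <- _ _; rewrite mulr_suml big_enum /=.
  by apply: eq_bigl => g; rewrite inE.
pose h (x : res (vL_fgp k v)) : vsum k (map (@rng _ _ G) s) :=
  to_vsum b s (phi (vLval (x : vL k v))).
have hL : linear h.
  move=> t x y; rewrite /h.
  rewrite -to_vsum_linear; congr (to_vsum _ _ _).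
  transitivity (phi ((vLval (x : vL k v) : lpa k E) * phi' t + vLval (y : vL k v))).
    by [].
  by rewrite rmorphD rmorphM phi'K.
have phix (x : vL k v) : of_vsum a (h x) = phi (vLval x).
  by rewrite /h (to_vsumK fr) phiP -rmorphM vL_valE.
exists (HB.pack h (GRing.isLinear.Build _ _ _ _ _ hL)
        : {linear res (vL_fgp k v) -> vsum k (map (@rng _ _ G) s)}).
split=> [|n x] /=.
  exists (fun z => vL_proj_to v (phi' (of_vsum a z))) => [x|z].
    by rewrite phix phiK vL_proj_toK.
  rewrite /h /= rmorphM phi'K -phiP -(to_vsumK fr).
  by rewrite !(of_vsumK fr).
split=> [xn|]; first by apply: (to_vsum_deg fr); apply: phideg.
by move/(of_vsum_deg fr)/phi'deg; rewrite phix phiK.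
Qed.

End VertexRestriction.

(** * Dimension groups *)

Section Powers.

Variables (T : pzSemiRingType) (n : nat) (A : 'M[T]_n).

Lemma expmx0 : A ^+ 0 = 1%:M. Proof. by []. Qed.
Lemma expmxS l : A ^+ l.+1 = A *m A ^+ l. Proof. exact: exprS. Qed.
Lemma expmxSr l : A ^+ l.+1 = A ^+ l *m A. Proof. exact: exprSr. Qed.
Lemma expmxD l j : A ^+ (l + j) = A ^+ l *m A ^+ j. Proof. exact: exprD. Qed.

End Powers.

Section NatMatrices.

Variable T : pzRingType.

Lemma natmx_mul m n p (A : 'M[nat]_(m, n)) (B : 'M[nat]_(n, p)) :
  natmx T (A *m B) = natmx T A *m natmx T B.
Proof.
apply/matrixP => i j; rewrite !mxE (big_morph _ (natrD T) (mulr0n 1)).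
by apply: eq_bigr => l _; rewrite !mxE natrM.
Qed.

Lemma natmx_exp n (A : 'M[nat]_n) l : natmx T (A ^+ l) = natmx T A ^+ l.
Proof.
elim: l => [|l IHl]; last by rewrite !expmxS natmx_mul IHl.
by rewrite !expmx0; apply/matrixP => i j; rewrite !mxE; case: eqP.
Qed.

Lemma natmx_intertwine m n (A : 'M[nat]_m) (B : 'M[nat]_n) (R : 'M[nat]_(m, n)) l :
  A *m R = R *m B ->
  natmx T A ^+ l *m natmx T R = natmx T R *m natmx T B ^+ l.
Proof.
move=> AR; rewrite -!natmx_exp -!natmx_mul; congr (natmx T _).
elim: l => [|l IHl]; first by rewrite !expmx0 mul1mx mulmx1.
by rewrite !expmxS -mulmxA IHl !mulmxA AR.
Qed.

End NatMatrices.

Lemma natmx_ratz m n (A : 'M[nat]_(m, n)) : map_mx intr (natmx int A) = natmx rat A.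
Proof. by apply/matrixP => i j; rewrite !mxE rmorph_nat. Qed.

Lemma natmx_inj m n : injective (@natmx rat m n).
Proof.
move=> A B /matrixP AB; apply/matrixP => i j; have := AB i j; rewrite !mxE.
by move/eqP; rewrite eqr_nat => /eqP.
Qed.

Lemma map_intr_inj m n : injective (map_mx intr : 'M[int]_(m, n) -> 'M[rat]_(m, n)).
Proof.
move=> A B /matrixP AB; apply/matrixP => i j; have := AB i j; rewrite !mxE.
exact: intr_inj.
Qed.

Lemma map_intr_floor m n (M : 'M[rat]_(m, n)) :
  M \is a mxOver Num.int -> map_mx intr (map_mx Num.floor M) = M.
Proof.
by move=> /mxOverP MP; apply/matrixP => i j; rewrite !mxE floorK ?MP.
Qed.

Lemma expmx_tr (T : comPzRingType) n (M : 'M[T]_n) j : M^T ^+ j = (M ^+ j)^T.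
Proof.
elim: j => [|j IHj]; first by rewrite !expmx0 trmx1.
by rewrite expmxSr expmxS trmx_mul IHj.
Qed.

Lemma map_intr_trexp n (A : 'M[nat]_n) j :
  map_mx intr ((natmx int A)^T ^+ j) = (natmx rat A ^+ j)^T.
Proof. by rewrite expmx_tr -map_trmx -(natmx_exp int) natmx_ratz natmx_exp. Qed.

Section DimensionGroup.

Variables (n : nat) (A : 'M[nat]_n).
Local Notation At := ((natmx int A)^T).
Local Notation cl := (dimG_class A).

Lemma dimG_rel_equiv : equivrel (dimG_rel A).
Proof.
have up (p q : 'cV[int]_n * nat) m j : (p.2 <= m)%N -> (q.2 <= m)%N ->
    At ^+ (m - p.2) *m p.1 = At ^+ (m - q.2) *m q.1 ->
    At ^+ (j + m - p.2) *m p.1 = At ^+ (j + m - q.2) *m q.1.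
  move=> pm qm e; rewrite -!addnBA // !expmxD.
  by rewrite -!mulmxA e.
split=> [p|p q [m [pm qm e]]|p q r [m [pm qm e]] [m' [qm' rm' e']]].
- by exists p.2.
- by exists m.
exists (m + m')%N; split.
- by rewrite (leq_trans pm) ?leq_addr.
- by rewrite (leq_trans rm') ?leq_addl.
by rewrite addnC (up _ _ _ _ pm qm e) addnC (up _ _ _ _ qm' rm' e').
Qed.

Lemma dimG_clsP v l w l' : cl v l = cl w l' <->
  exists m, [/\ (l <= m)%N, (l' <= m)%N & At ^+ (m - l) *m v = At ^+ (m - l') *m w].
Proof. exact: clsP dimG_rel_equiv. Qed.

Lemma dimG_class_up v l j : cl v l = cl (At ^+ j *m v) (j + l).
Proof.
apply/dimG_clsP; exists (j + l)%N; rewrite leq_addl leqnn addnK subnn.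
by rewrite expmx0 mul1mx.
Qed.

Lemma dimG_repr a : exists v l, a = cl v l.
Proof. by exists (rep a).1, (rep a).2; rewrite /dimG_class -surjective_pairing repK. Qed.

(** Any two classes can be written at a common level, where sums and equality are
    easy to compute. *)
Lemma dimG_repr2 a b : exists v w l, a = cl v l /\ b = cl w l.
Proof.
have [v [l ->]] := dimG_repr a; have [w [l' ->]] := dimG_repr b.
exists (At ^+ l' *m v), (At ^+ l *m w), (l' + l)%N.
by rewrite -dimG_class_up addnC -dimG_class_up.
Qed.

Lemma dimG_repP v l : exists v' l',
  rep (cl v l) = (v', l') /\ cl v' l' = cl v l.
Proof.
case E : (rep (cl v l)) => [v' l']; exists v', l'; split=> //.
by rewrite /dimG_class -E repK.
Qed.

Lemma dimG_eqP v w l : cl v l = cl w l <-> exists m, At ^+ m *m v = At ^+ m *m w.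
Proof.
split=> [/dimG_clsP[m [_ _ e]]|[m e]]; first by exists (m - l)%N.
by apply/dimG_clsP; exists (m + l)%N; rewrite leq_addl addnK.
Qed.

Lemma dimG_addE v l w l' : dimG_add (cl v l) (cl w l') =
  cl (At ^+ l' *m v + At ^+ l *m w) (l + l').
Proof.
rewrite /dimG_add.
have [v1 [l1 [-> /dimG_clsP[m [lm lm1 e]]]]] := dimG_repP v l.
have [w1 [l1' [-> /dimG_clsP[m' [lm' lm1' e']]]]] := dimG_repP w l'.
apply/dimG_clsP; exists (m + m')%N; split; try exact: leq_add.
rewrite !mulmxDr !mulmxA -!expmxD.
have -> : (m + m' - (l1 + l1') + l1' = m' + (m - l1))%N by lia.
have -> : (m + m' - (l1 + l1') + l1 = m + (m' - l1'))%N by lia.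
have -> : (m + m' - (l + l') + l' = m' + (m - l))%N by lia.
have -> : (m + m' - (l + l') + l = m + (m' - l'))%N by lia.
by rewrite !(expmxD _ m) !(expmxD _ m') -!mulmxA e e'.
Qed.

Lemma dimG_add_same v w l : dimG_add (cl v l) (cl w l) = cl (v + w) l.
Proof.
by rewrite dimG_addE -mulmxDr [in LHS]/dimG_class -/(cl _ _) -dimG_class_up.
Qed.

Lemma dimG_xE v l : dimG_x (cl v l) = cl (At *m v) l.
Proof.
rewrite /dimG_x; have [v1 [l1 [-> /dimG_clsP[m [lm lm1 e]]]]] := dimG_repP v l.
apply/dimG_clsP; exists m; split=> //; rewrite !mulmxA -!expmxSr !expmxS.
by rewrite -!mulmxA e.
Qed.

Lemma dimG_x_inj : injective (@dimG_x n A).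
Proof.
move=> a b; have [v [w [l [-> ->]]]] := dimG_repr2 a b; rewrite !dimG_xE.
move=> /dimG_eqP[m]; rewrite !mulmxA -!expmxSr => e.
by apply/dimG_eqP; exists m.+1.
Qed.

Lemma dimG_addIr c : injective (fun a => @dimG_add n A a c).
Proof.
move=> a b; have [v [w [l [-> ->]]]] := dimG_repr2 a b.
have [u [l' ->]] := dimG_repr c; rewrite !dimG_addE => /dimG_eqP[m].
rewrite !mulmxDr => /addIr; rewrite !mulmxA -!expmxD => e.
by apply/dimG_eqP; exists (m + l')%N.
Qed.

(** The only idempotent of the group; it serves to identify the values of additive
    maps at the zero module. *)
Lemma dimG_idem a : dimG_add a a = a -> a = cl 0 0.
Proof.
have [v [l ->]] := dimG_repr a; rewrite dimG_add_same => /dimG_eqP[m].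
rewrite mulmxDr => /eqP; rewrite -subr_eq0 addrK => /eqP e.
by apply/dimG_clsP; exists (m + l)%N; rewrite leq_addl addnK e mulmx0.
Qed.

Lemma dimG_iter_x j v l : iter j (@dimG_x n A) (cl v l) = cl (At ^+ j *m v) l.
Proof.
elim: j => [|j IHj]; first by rewrite expmx0 mul1mx.
by rewrite iterS IHj dimG_xE mulmxA expmxS.
Qed.

(** The definition of psi takes the least l for which v A^l is integral; any other
    one gives the same class. *)
Lemma psiE (v : Delta A) (u : 'cV[int]_n) l :
  v *m natmx rat A ^+ l = (map_mx intr u)^T -> psi v = cl u l.
Proof.
move=> vu; rewrite /psi; case: ex_minnP => l0 l0int l0min.
have ll : (l0 <= l)%N.
  by apply: l0min; rewrite vu; apply/mxOverP => i j; rewrite !mxE intr_int.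
rewrite (dimG_class_up _ l0 (l - l0)) subnK //; congr (cl _ l).
apply: map_intr_inj; rewrite map_mxM map_intr_trexp -map_trmx map_intr_floor //.
by rewrite -trmx_mul -mulmxA -expmxD subnKC // vu trmxK.
Qed.

Lemma psi_repr (v : Delta A) : exists u l,
  v *m natmx rat A ^+ l = (map_mx intr u)^T /\ psi v = cl u l.
Proof.
have [l vl] := dvec_int v.
exists (map_mx Num.floor (v *m natmx rat A ^+ l))^T, l.
suff e : v *m natmx rat A ^+ l =
    (map_mx intr (map_mx Num.floor (v *m natmx rat A ^+ l))^T)^T.
  by split; last exact: psiE.
by rewrite -map_trmx trmxK map_intr_floor.
Qed.

(** In the limit group the order unit is represented by the row of ones, so that it
    coincides with it after multiplication by a power of A. *)
Lemma order_unitP (v : Delta A) : is_order_unit v ->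
  exists l0, forall l, (l0 <= l)%N -> v *m natmx rat A ^+ l = const_mx 1 *m natmx rat A ^+ l.
Proof.
rewrite /is_order_unit; have [u [l [vu ->]]] := psi_repr v.
move=> /dimG_clsP[m [lm _ /(congr1 (map_mx (intr : int -> rat)))]].
rewrite subn0 !map_mxM !map_intr_trexp => /(congr1 trmx).
rewrite !trmx_mul !trmxK -vu -mulmxA -expmxD subnKC // => e.
exists m => j mj; rewrite -(subnKC mj) expmxD !mulmxA e; congr (_ *m _ *m _).
by apply/matrixP => i r; rewrite !mxE.
Qed.

End DimensionGroup.

Section DimensionMap.

Variables (m n : nat) (A : 'M[nat]_m) (B : 'M[nat]_n) (R : 'M[nat]_(m, n)).
Hypothesis AR : A *m R = R *m B.
Local Notation At := ((natmx int A)^T).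
Local Notation Bt := ((natmx int B)^T).
Local Notation Rt := ((natmx int R)^T).

Lemma Rt_intertwine l : Rt *m At ^+ l = Bt ^+ l *m Rt.
Proof. by rewrite !expmx_tr -!trmx_mul (natmx_intertwine _ _ AR). Qed.

(** The action of R on dimension groups in the limit description, where it is easily
    compared with maps of K-groups. *)
Definition dimG_map (a : dimG A) : dimG B :=
  let: (v, l) := rep a in dimG_class B (Rt *m v) l.

Lemma dimG_mapE v l : dimG_map (dimG_class A v l) = dimG_class B (Rt *m v) l.
Proof.
rewrite /dimG_map; have [v1 [l1 [-> /dimG_clsP[j [lj lj1 e]]]]] := dimG_repP A v l.
by apply/dimG_clsP; exists j; split=> //; rewrite !mulmxA -!Rt_intertwine -!mulmxA e.
Qed.

Lemma dimG_map_add a b :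
  dimG_map (dimG_add a b) = dimG_add (dimG_map a) (dimG_map b).
Proof.
have [v [w [l [-> ->]]]] := dimG_repr2 a b.
by rewrite dimG_add_same !dimG_mapE dimG_add_same mulmxDr.
Qed.

Lemma dimG_map_x a : dimG_map (dimG_x a) = dimG_x (dimG_map a).
Proof.
have [v [l ->]] := dimG_repr a; rewrite dimG_xE !dimG_mapE dimG_xE !mulmxA.
by have := Rt_intertwine 1; rewrite !expr1 => ->.
Qed.

(** The map v |-> v R in the description by row vectors is [dimG_map]: since
    v R B^l = v A^l R, both conditions defining the dimension group of B pass from v
    to v R. *)
Lemma dim_map_psi (v : Delta A) : exists w : Delta B,
  dim_map R v w /\ psi w = dimG_map (psi v).
Proof.
have AqR l := natmx_intertwine rat l AR.
have range l : (1 <= l)%N -> exists u : 'rV[rat]_n,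
    v *m natmx rat R = u *m natmx rat B ^+ l.
  move=> l1; have [u ->] := dvec_range v l1.
  by exists (u *m natmx rat R); rewrite -!mulmxA AqR.
have [u [l [vu pv]]] := psi_repr v.
have wl : v *m natmx rat R *m natmx rat B ^+ l = (map_mx intr (Rt *m u))^T.
  rewrite -mulmxA -AqR mulmxA vu map_mxM trmx_mul -map_trmx trmxK natmx_ratz.
  by [].
have int : exists l, v *m natmx rat R *m natmx rat B ^+ l \is a mxOver Num.int.
  by exists l; rewrite wl; apply/mxOverP => i j; rewrite 2!mxE intr_int.
by exists (MkDelta range int); split=> //; rewrite pv dimG_mapE; apply: psiE.
Qed.

End DimensionMap.

Lemma dimG_map_comp m n p (A : 'M[nat]_m) (B : 'M[nat]_n) (C : 'M[nat]_p)
    (R : 'M[nat]_(m, n)) (S : 'M[nat]_(n, p)) (a : dimG A) :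
  A *m R = R *m B -> B *m S = S *m C ->
  dimG_map C S (dimG_map B R a) = dimG_map C (R *m S) a.
Proof.
move=> AR BS; have ARS : A *m (R *m S) = R *m S *m C by rewrite mulmxA AR -!mulmxA BS.
have [v [l ->]] := dimG_repr a.
by rewrite !dimG_mapE // mulmxA -trmx_mul natmx_mul.
Qed.

Lemma dimG_map_exp n (A : 'M[nat]_n) j (a : dimG A) :
  dimG_map A (A ^+ j) a = iter j (@dimG_x n A) a.
Proof.
have [v [l ->]] := dimG_repr a.
have AA : A *m A ^+ j = A ^+ j *m A by rewrite -expmxS expmxSr.
by rewrite dimG_mapE // dimG_iter_x natmx_exp expmx_tr.
Qed.

(** The equality of the images of the order units in rational row vectors becomes
    one of natural numbers after multiplication by a high power. The exponent is
    positive in order to be the length of a path in the sense of tpow. *)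
Lemma unital_counts m n (A : 'M[nat]_m) (B : 'M[nat]_n) (R : 'M[nat]_(m, n)) :
  A *m R = R *m B -> unital_dim_map A B R ->
  exists l, (const_mx 1 : 'rV[nat]_m) *m (R *m B ^+ l.+1) = const_mx 1 *m B ^+ l.+1.
Proof.
move=> AR [u [w [/order_unitP[l ul] /order_unitP[l' wl] uw]]].
exists (l + l')%N; apply: (@natmx_inj _ _).
have one (r : nat) : natmx rat (const_mx 1 : 'rV[nat]_r) = const_mx 1.
  by apply/matrixP => i j; rewrite !mxE.
rewrite !natmx_mul !natmx_exp !one -wl; last by lia.
rewrite uw -mulmxA -(natmx_intertwine _ _ AR) !mulmxA ul //; lia.
Qed.

(** * The induced map on dimension groups *)

Lemma K0_class_iso (T : grring) (P Q : fgproj T) : fgp_iso P Q -> K0_class P = K0_class Q.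
Proof.
move=> PQ; have e : vgr_class P = vgr_class Q by apply/(clsP _ _ (@fgp_iso_equiv T)).
by rewrite /K0_class e.
Qed.

Section VertexSums.

Variables (k : fieldType) (E : graph).
Variable (beta : K0gr (lpa_gr k E) -> dimG (adj E)).
Hypothesis betaP : is_beta beta.

Definition vsum_vec (s : seq (vert E)) : 'cV[int]_#|vert E| :=
  \sum_(v <- s) delta_mx (enum_rank v) 0.

Lemma beta_vsum s :
  beta (K0_class (vsum k s)) = dimG_class (adj E) (vsum_vec s) 0.
Proof.
case: betaP => _ betaD _ _ betav; rewrite /vsum_vec.
elim: s => [|v s IHs] /=.
  rewrite big_nil; apply: dimG_idem.
  rewrite -betaD -K0_class_sum; congr beta; apply: K0_class_iso.
  exact: fgp_sum0.
by rewrite big_cons K0_class_sum betaD betav IHs dimG_add_same.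
Qed.

Lemma vsum_vec_exists (u : 'cV[int]_#|vert E|) :
  (forall i, 0 <= u i 0) -> exists s, vsum_vec s = u.
Proof.
move=> u0; exists (flatten [seq nseq `|u i ord0|%N (enum_val i) | i <- enum 'I_#|vert E|]).
rewrite /vsum_vec big_flatten big_map big_enum /=.
rewrite [RHS]matrix_sum_delta; apply: eq_bigr => i _.
rewrite big_ord1 big_nseq iter_addr_0 enum_valK.
by rewrite -{2}[u i 0]gez0_abs // -natz scaler_nat.
Qed.

End VertexSums.

Lemma int_vec_diff n (v : 'cV[int]_n) : exists p q : 'cV[int]_n,
  [/\ forall i, 0 <= p i 0, forall i, 0 <= q i 0 & v + q = p].
Proof.
exists (\col_i (`|v i 0| + v i 0)), (\col_i `|v i 0|); split=> [i|i|].
- by rewrite mxE; lia.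
- by rewrite mxE.
- by apply/matrixP => i j; rewrite !mxE ord1 addrC.
Qed.

(** The column of index v of the transpose of R lists the ranges of the edges of
    G that start at v. *)
Lemma vsum_vec_edges (E F : graph) (R : 'M[nat]_(#|vert E|, #|vert F|)) (v : vert E) :
  vsum_vec (map (@rng _ _ (mx_edges R)) (enum [pred g : mx_edges R | src g == v])) =
  (natmx int R)^T *m delta_mx (enum_rank v) 0.
Proof.
rewrite /vsum_vec big_map big_enum -colE; apply/matrixP => i j.
rewrite !mxE summxE -[R in RHS]count_mx_mx_edges count_mxE enum_rankK.
rewrite (big_morph _ (natrD int) (mulr0n 1)).
apply: eq_big => [g|g _]; first by rewrite inE.
by rewrite !mxE ord1 eqxx andbT -(can_eq enum_rankK) enum_valK eq_sym; case: eqP.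
Qed.

Section InducedMap.

Variables (k : fieldType) (E F : graph) (R : 'M[nat]_(#|vert E|, #|vert F|)).
Variables (phi : {rmorphism lpa_gr k E -> lpa_gr k F})
          (phi' : {rmorphism lpa_gr k F -> lpa_gr k E}).
Hypotheses (phiK : cancel phi phi') (phi'K : cancel phi' phi).
Hypothesis phideg : forall n t, lpa_deg n t -> lpa_deg n (phi t).
Hypothesis phi'deg : forall n t, lpa_deg n t -> lpa_deg n (phi' t).
Variables a b : mx_edges R -> lpa k F.
Hypothesis fr : frame 0 a b (fun v => phi (lpa_vert k v)) (@lpa_vert k F).
Hypothesis AR : adj E *m R = R *m adj F.
Variables (betaE : K0gr (lpa_gr k E) -> dimG (adj E))
          (betaF : K0gr (lpa_gr k F) -> dimG (adj F)).
Hypotheses (bE : is_beta betaE) (bF : is_beta betaF).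

Local Notation f := (@K0_restr _ _ phi phi' phiK phi'K phideg phi'deg).
Local Notation theta := (dimG_map (adj F) R).

(** On the generators this is [restr_vertex], followed by the count of the edges of
    G with source v. *)
Lemma beta_restr_vsum s :
  betaF (f (K0_class (vsum k s))) = theta (betaE (K0_class (vsum k s))).
Proof.
have [fD _] := K0_restr_is_map phiK phi'K phideg phi'deg.
case: (bE) => _ betaED _ _ betaEv; case: (bF) => _ betaFD _ _ _.
elim: s => [|v s IHs] /=.
  rewrite (_ : betaE _ = dimG_class (adj E) 0 0).
    rewrite (dimG_mapE AR) mulmx0; apply: dimG_idem.
    rewrite -betaFD -fD -K0_class_sum; congr (betaF (f _)); apply: K0_class_iso.
    exact: fgp_sum0.
  by rewrite (beta_vsum bE [::]) /vsum_vec big_nil.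
rewrite K0_class_sum fD betaFD betaED (dimG_map_add AR).
apply: congr2 IHs.
rewrite K0_restr_class betaEv (dimG_mapE AR).
rewrite (K0_class_iso (restr_vertex phiK phi'K phideg phi'deg fr v)).
by rewrite (beta_vsum bF) vsum_vec_edges.
Qed.

(** Both sides are additive and commute with x, which acts injectively on the
    dimension group. A power of x moves any class to level 0, and at level 0 an
    integral vector is a difference of vectors [vsum_vec]. *)
Lemma beta_restr x : betaF (f x) = theta (betaE x).
Proof.
have [fD _] := K0_restr_is_map phiK phi'K phideg phi'deg.
case: (bE) => bijE betaED betaEx _ _; case: (bF) => _ betaFD betaFx _ _.
have level0 y v : betaE y = dimG_class (adj E) v 0 -> betaF (f y) = theta (betaE y).
  move=> yv; have [p [q [p0 q0 vqp]]] := int_vec_diff v.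
  have [s sp] := vsum_vec_exists p0; have [s' sq] := vsum_vec_exists q0.
  have : K0_add y (K0_class (vsum k s')) = K0_class (vsum k s).
    apply: (bij_inj bijE); rewrite betaED yv !(beta_vsum bE) dimG_add_same.
    by rewrite sp sq vqp.
  move=> e; apply: (dimG_addIr (c := theta (betaE (K0_class (vsum k s'))))).
  by rewrite /= -(dimG_map_add AR) -betaED -beta_restr_vsum -betaFD -fD e beta_restr_vsum.
have [v [l xv]] := dimG_repr (betaE x).
have iE j y : betaE (iter j (@K0_shift _) y) = iter j (@dimG_x _ _) (betaE y).
  by elim: j => //= j <-.
have iF j y : betaF (f (iter j (@K0_shift _) y)) = iter j (@dimG_x _ _) (betaF (f y)).
  by elim: j => //= j IHj; rewrite K0_restr_shift betaFx IHj.
have it j (y : dimG (adj E)) : theta (iter j (@dimG_x _ _) y) = iter j (@dimG_x _ _) (theta y).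
  by elim: j => [//|j IHj]; rewrite !iterS (dimG_map_x AR) IHj.
have /level0 : betaE (iter l (@K0_shift _) x) = dimG_class (adj E) v 0.
  by rewrite iE xv dimG_iter_x [RHS](dimG_class_up _ _ _ l) addn0.
rewrite iE iF it; elim: l {xv} => //= l IHl /dimG_x_inj; exact: IHl.
Qed.

End InducedMap.

Section InducedDimensionMaps.

Variables (k : fieldType) (E F : graph).
Variables (R : 'M[nat]_(#|vert E|, #|vert F|)) (S : 'M[nat]_(#|vert F|, #|vert E|)).
Variables (phi : {rmorphism lpa_gr k E -> lpa_gr k F})
          (phi' : {rmorphism lpa_gr k F -> lpa_gr k E}).
Hypothesis iso : graded_iso phi phi'.
Variables a b : mx_edges R -> lpa k F.
Hypothesis fr : frame 0 a b (fun v => phi (lpa_vert k v)) (@lpa_vert k F).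
Hypothesis AR : adj E *m R = R *m adj F.

Let phiK : cancel phi phi'. Proof. by case: iso. Qed.
Let phi'K : cancel phi' phi. Proof. by case: iso. Qed.
Let phideg n t : lpa_deg n t -> lpa_deg n (phi t).
Proof. by case: iso => _ _ _ d /d. Qed.
Let phi'deg n t : lpa_deg n t -> lpa_deg n (phi' t).
Proof. by case: iso => _ _ _ d tn; apply/d; rewrite phi'K. Qed.

Lemma iso_induces : induces_dim_map phi 0 R.
Proof.
exists (K0_restr phiK phi'K phideg phi'deg); split; first exact: K0_restr_is_map.
move=> betaE betaF bE bF x v vx; have [w [vw we]] := dim_map_psi AR v.
exists w; split=> //; rewrite we vx.
exact/esym/(beta_restr phiK phi'K phideg phi'deg fr AR bE bF).
Qed.

(** Restricting along phi and then along its inverse gives back the module with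
    its original scalars. *)
Lemma K0_restrK : cancel (K0_restr phi'K phiK phi'deg phideg)
  (K0_restr phiK phi'K phideg phi'deg).
Proof.
have vK y : vgr_restr phiK phi'K phideg phi'deg
    (vgr_restr phi'K phiK phi'deg phideg y) = y.
  have [P ->] := vgr_repr y; rewrite !vgr_restrE.
  apply/(clsP _ _ (@fgp_iso_equiv (lpa_gr k F))).
  pose h (x : fgp_restr phiK phi'K phideg phi'deg
    (fgp_restr phi'K phiK phi'deg phideg P)) : P := x.
  have hL : linear h.
    move=> t x y'; rewrite /h.
    by rewrite -[in RHS](phi'K t).
  exists (HB.pack h (GRing.isLinear.Build _ _ _ _ _ hL) : {linear _ -> P}).
  by split=> //; exists id.
move=> x; have [P [Q ->]] := K0_repr x.
by rewrite !K0_restrE /= !vK.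
Qed.

(** The inverse of the map R, followed by R S = A^m, is S; and A^m acts as x^m. *)
Lemma iso_inv_induces m : adj F *m S = S *m adj E -> R *m S = adj E ^+ m ->
  induces_dim_map phi' m S.
Proof.
move=> BS RS; exists (K0_restr phi'K phiK phi'deg phideg).
split; first exact: K0_restr_is_map.
move=> betaF betaE bF bE x v vx; have [w [vw we]] := dim_map_psi BS v.
exists w; split=> //; rewrite we vx -{1}(K0_restrK x).
rewrite (beta_restr phiK phi'K phideg phi'deg fr AR bE bF).
rewrite (dimG_map_comp _ AR BS) RS dimG_map_exp.
case: bE => _ _ bx _ _; elim: m {RS} => //= m ->.
by rewrite bx.
Qed.

End InducedDimensionMaps.

(** * The theorem *)

Section Assembly.

Variables (k : fieldType) (E F : graph).
Variables (R : 'M[nat]_(#|vert E|, #|vert F|)) (S : 'M[nat]_(#|vert F|, #|vert E|)).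

Lemma aligned_mse_sym (G : edgeset (vert E) (vert F)) (H : edgeset (vert F) (vert E)) :
  aligned_mse k G H -> aligned_mse k H G.
Proof. by move=> [n [oE [oF [sG [sH [[? ? ? ?] ? ?]]]]]]; exists n, oF, oE, sH, sG. Qed.

Lemma aligned_mse_shift_equiv : aligned_mse k (mx_edges R) (mx_edges S) ->
  [/\ adj E *m R = R *m adj F, adj F *m S = S *m adj E
    & exists n, R *m S = adj E ^+ n.+1].
Proof.
move=> [n [omE [omF [sgG [sgH [[iE iF iG iH] _ _]]]]]].
have := bimod_iso_count_mx iG; have := bimod_iso_count_mx iH; have := bimod_iso_count_mx iE.
rewrite count_mx_tpow !count_mx_ecomp !count_mx_mx_edges => RS BS AR.
by split=> //; exists n.
Qed.

(** Besides 1 R B^l = 1 B^l one needs the corresponding equality for S; it follows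
    from 1 S A^(l+1) = 1 B^(l+1) S = 1 R B^(l+1) S = 1 A^(l+1) R S
    = 1 A^(l+1+m), where m is the lag. So the frame over H has degree m. *)
Lemma unital_mse_iso (hE : no_sinks E) (hF : no_sinks F) :
  aligned_mse k (mx_edges R) (mx_edges S) -> unital_dim_map (adj E) (adj F) R ->
  exists (phi : {rmorphism lpa_gr k E -> lpa_gr k F})
         (phi' : {rmorphism lpa_gr k F -> lpa_gr k E}),
    [/\ graded_iso phi phi', induces_dim_map phi 0 R
      & exists2 m : nat, (0 < m)%N & induces_dim_map phi' m S].
Proof.
move=> al uR; have [AR BS [n RS]] := aligned_mse_shift_equiv al.
have [l cR] := unital_counts AR uR.
have [a [b [P fR]]] : exists a b P,
    frame (l%:Z - l%:Z) a b P (@lpa_vert k F) (X := mx_edges R).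
  by apply: frame_exists => //; rewrite count_mx_mx_edges.
have [c [c' [Q fS]]] : exists a b P,
    frame ((n.+1 + l)%N%:Z - l%:Z) a b P (@lpa_vert k E) (X := mx_edges S).
  apply: frame_exists => //; rewrite count_mx_mx_edges.
  have lS j : S *m adj E ^+ j = adj F ^+ j *m S.
    elim: j => [|j IHj]; first by rewrite !expmx0 mul1mx mulmx1.
    by rewrite expmxSr mulmxA IHj -mulmxA -BS mulmxA -expmxSr.
  have lR j : R *m adj F ^+ j = adj E ^+ j *m R.
    elim: j => [|j IHj]; first by rewrite !expmx0 mul1mx mulmx1.
    by rewrite expmxSr mulmxA IHj -mulmxA -AR mulmxA -expmxSr.
  rewrite lS mulmxA -cR lR -!mulmxA RS -expmxD; congr (_ *m _ ^+ _).
  lia.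
rewrite subrr in fR.
have [phi [phi' [iso fR']]] := aligned_mse_graded_iso hE hF al fR fS.
exists phi, phi'; split; first exact: iso.
  exact (iso_induces iso fR' AR).
by exists n.+1; last exact (iso_inv_induces iso fR' AR BS RS).
Qed.

End Assembly.

Theorem corollary5p7 (k : fieldType) (E F : graph)
    (R : 'M[nat]_(#|vert E|, #|vert F|)) (S : 'M[nat]_(#|vert F|, #|vert E|))
    (hE : no_sinks E) (hF : no_sinks F)
    (hRS : unitally_aligned_mse k R S) :
  (unital_dim_map (adj E) (adj F) R ->
     exists (phi : {rmorphism lpa_gr k E -> lpa_gr k F})
            (phi' : {rmorphism lpa_gr k F -> lpa_gr k E}),
       [/\ graded_iso phi phi', induces_dim_map phi 0 R
         & exists2 m : nat, (0 < m)%N & induces_dim_map phi' m S]) /\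
  (unital_dim_map (adj F) (adj E) S ->
     exists (phi : {rmorphism lpa_gr k E -> lpa_gr k F})
            (phi' : {rmorphism lpa_gr k F -> lpa_gr k E}),
       [/\ graded_iso phi phi', induces_dim_map phi' 0 S
         & exists2 m : nat, (0 < m)%N & induces_dim_map phi m R]).
Proof.
case: hRS => _ al; split; first exact: unital_mse_iso.
move=> uS; have [psi [psi' [[psiK psi'K psiZ psid] iS iR]]] :=
  unital_mse_iso hF hE (aligned_mse_sym al) uS.
exists psi', psi; split=> //; split=> // [c x|n x].
  by apply: (can_inj psiK); rewrite psiZ !psi'K.
by rewrite -{1}(psi'K x) psid.
Qed.
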